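(* Let Willie's and Alice's service times be exponential with rates $\mu_1$ and $\mu_2$, and let Alice use the II-A policy $(q,Q)$, where $Q$ is a probability distribution on $\{0,1,2,\dots\}$ whose support is finite. Let $T(n)$ be the expected number of jobs Alice inserts over $n$ W-BPs. For all $\mu_1$ and $\mu_2$, Alice is not covert if $T(n)=\omega(\sqrt n)$. (The meaning of ''not covert'' is given in the context.)
   Context: Model. Willie's jobs arrive according to a Poisson process of rate $\lambda\in(0,\infty)$ to a single-server FIFO queue, empty at time $0$. Willie's service times are iid exponential with rate $\mu_1$, Alice's are iid exponential with rate $\mu_2$; service times, arrivals and Alice's randomizations are mutually independent. Alice's jobs cannot be preempted once in service. Let $A_i,D_i$ be the arrival and departure times of Willie's $i$-th job. The reconstructed service times are $S_1=D_1-A_1$ and $S_i=D_i-\max\{A_i,D_{i-1}\}$ for $i\ge2$. A Willie Busy Period (W-BP) is the time interval from the arrival of a Willie job finding no other Willie job in the system to the first subsequent departure of a Willie job leaving no other Willie job in the system. II-A (Insert-at-Idle-and-at-Arrivals) policy $(q,Q)$: each time the server idles, Alice inserts one job with probability $q$ and does not insert a job with probability $1-q$; immediately after the arrival of each Willie job, Alice inserts a batch of $s\ge0$ jobs with probability $qQ(s)$, and with probability $1-q$ she does not insert any job; successive batch sizes are mutually independent. Let $B=\sum_s sQ(s)$, $\rho_1=\lambda/\mu_1<1$, $\rho_2=\lambda/\mu_2$; it is assumed throughout that $q$ satisfies the stability condition $\rho_1+q\rho_2B<1$. $H_0$: Alice inserts no jobs; $H_1$: Alice uses the policy $(q(n),Q)$,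 where $n$ is the number of W-BPs observed by Willie and $q$ depends on $n$. Willie observes, for each of the first $n$ W-BPs, the number of his jobs served and their arrival and reconstructed service times. For a test, $P_E$ is the sum of its false alarm and missed detection probabilities; the minimum over tests is $P_E^\star=1-T_V$, where $T_V$ is the total variation distance between the laws of Willie's observation under $H_0$ and $H_1$. Alice's insertions are covert if for any $\epsilon>0$ she has an insertion strategy for each $n$ such that $\liminf_nP_E^\star\ge1-\epsilon$. ''Alice is not covert if $T(n)=\omega(\sqrt n)$'' means: there is $\epsilon_0>0$ such that for every sequence $q(n)$ with $T(n)/\sqrt n\to\infty$ one has $\liminf_nP_E^\star<1-\epsilon_0$. *)

(* Defs.v *)
From HB Require Import structures.
From mathcomp Require Import all_boot all_order all_algebra finmap.
From mathcomp Require Import all_classical all_reals all_analysis.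
From mathcomp Require Import lra.

Set Implicit Arguments.
Unset Strict Implicit.
Unset Printing Implicit Defensive.

Import Order.TTheory GRing.Theory Num.Theory.
Import numFieldNormedType.Exports.

Local Open Scope classical_set_scope.
Local Open Scope ring_scope.

(* One realization of the randomness. Willie's jobs are numbered from 0 and   *)
(* gap 0 is the first arrival time and gap i.+1 the time between arrivals i   *)
(* and i.+1. The batch inserted by Alice right after arrival i has batch i    *)
(* jobs, the j-th of which needs bsvc i j. The k-th time the server idles     *)
(* between the completion of the batch of Willie's job i.-1 (time 0 if i = 0) *)
(* and the arrival of Willie's job i, Alice inserts a job iff icoin i k, and  *)
(* that job needs isvc i k.                                                   *)
Record sample_path (R : Type) := SamplePath {
  gap : nat -> R;
  wsvc : nat -> R;
  bsvc : nat -> nat -> R;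
  isvc : nat -> nat -> R;
  icoin : nat -> nat -> bool;
  batch : nat -> nat }.

Section queue.
Context {R : realType}.
Implicit Types (s : sample_path R) (e a : R) (c : nat -> bool) (z : nat -> R).

Definition arrival s i : R := \sum_(j < i.+1) gap s j.

(* Insertions at idle instants, when the server has emptied at time e and the *)
(* next Willie job arrives at time a. If jobs 0, ..., j.-1 were inserted,     *)
(* the server idles again at e + \sum_(l < j) z l, provided that this is      *)
(* before a; job j is then inserted iff c j holds.                            *)
Definition idle_insert e a c z (k : nat) : bool :=
  [forall j : 'I_k.+1, c j && (e + \sum_(l < j) z l < a)].

(* The time from which the server is no longer busy with these jobs. The sum  *)
(* converges even if all idle_insert e a c z k hold, since it is then at most *)
(* a - e (for nonnegative z).                                                 *)
Definition idle_done e a c z : R :=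
  limn (fun m => e + \sum_(0 <= k < m | idle_insert e a c z k) z k).

Definition serve s i e : R :=
  Num.max (arrival s i) (idle_done e (arrival s i) (icoin s i) (isvc s i))
  + wsvc s i.

(* clear s i is the time at which the server completes Willie's jobs          *)
(* 0, ..., i.-1 and their batches, all of which precede Willie's job i in the *)
(* FIFO order. At time 0 the server is idle.                                  *)
Fixpoint clear s i : R :=
  if i is i'.+1
  then serve s i' (clear s i') + \sum_(j < batch s i') bsvc s i' j
  else 0.

Definition departure s i : R := serve s i (clear s i).

Definition recon s i : R :=
  if i is i'.+1
  then departure s i - Num.max (arrival s i) (departure s i')
  else departure s 0 - arrival s 0.

(* The index (from 0) of the W-BP of Willie's job i: one W-BP ends at each    *)
(* departure that leaves no other Willie job in the system.                   *)
Definition wbp_index s i : nat :=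
  (\sum_(k < i) (departure s k <= arrival s k.+1)%R)%N.

(* This is 0 if the W-BP never ends, as fset_set maps infinite sets to fset0; *)
(* such W-BPs have probability 0 under the stability condition.               *)
Definition wbp_size s j : nat := #|` fset_set [set i | wbp_index s i = j]|.

Definition wbp_first s j : nat := (\sum_(j' < j) wbp_size s j')%N.

Definition wbp_record s j : seq (R * R) :=
  [seq (arrival s i, recon s i) | i <- iota (wbp_first s j) (wbp_size s j)].

(* The number of jobs inserted by Alice up to the end of the n-th W-BP.       *)
Definition inserted s (n : nat) : \bar R :=
  (\sum_(i <oo | (wbp_index s i < n)%N)
     ((batch s i)%:R%:E
      + \sum_(k <oo | idle_insert (clear s i) (arrival s i)
                                  (icoin s i) (isvc s i) k) 1))%E.

End queue.

(* The sigma-algebra on the disjoint union of the (R * R) ^ k, k : nat.       *)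
Definition record_gen (R : realType) : set (set (seq (R * R))) :=
  preimage_set_system setT size setT
  `|` \bigcup_k preimage_set_system setT (fun r => nth (0, 0) r k)
                  (measurable : set (set (R * R))).

HB.instance Definition _ (T : choiceType) := isPointed.Build (seq T) [::].

Definition record_space (R : realType) := g_sigma_algebraType (@record_gen R).

HB.instance Definition _ (R : realType) := Measurable.on (record_space R).

Definition observation (R : realType) (n : nat) (s : sample_path R) :
    n.-tuple (record_space R) :=
  [tuple (wbp_record s j : record_space R) | j < n].

Definition mutual_indep d (T : measurableType d) (R : realType)
    (P : probability T R) (I : choiceType) (F : I -> set (set T)) : Prop :=
  forall (J : {fset I}) (E : I -> set T),
    (forall i, i \in J -> F i (E i)) ->
    P (\bigcap_(i in [set` J]) E i) = (\prod_(i <- J) P (E i))%E.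

Definition has_law d d' (T : measurableType d) (T' : measurableType d')
    (R : realType) (P : probability T R) (X : {RV P >-> T'})
    (m : set T' -> \bar R) : Prop :=
  forall A, measurable A -> distribution P X A = m A.

Record primitives d (T : measurableType d) (R : realType)
    (P : probability T R) := Primitives {
  rgap : nat -> {RV P >-> R};
  rwsvc : nat -> {RV P >-> R};
  rbsvc : nat -> nat -> {RV P >-> R};
  risvc : nat -> nat -> {RV P >-> R};
  ricoin : nat -> nat -> {RV P >-> bool};
  racoin : nat -> {RV P >-> bool};
  rsize : nat -> {RV P >-> nat} }.

Inductive source :=
  | Gap of nat
  | WSvc of nat
  | BSvc of nat & nat
  | ISvc of nat & nat
  | ICoin of nat & nat
  | ACoin of nat
  | BSize of nat.

HB.instance Definition _ := gen_eqMixin source.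
HB.instance Definition _ := gen_choiceMixin source.

Section model.
Context d (T : measurableType d) (R : realType) (P : probability T R).
Implicit Types (X : primitives P).

Definition source_events X (u : source) : set (set T) :=
  match u with
  | Gap i => preimage_set_system setT (rgap X i) measurable
  | WSvc i => preimage_set_system setT (rwsvc X i) measurable
  | BSvc i j => preimage_set_system setT (rbsvc X i j) measurable
  | ISvc i k => preimage_set_system setT (risvc X i k) measurable
  | ICoin i k => preimage_set_system setT (ricoin X i k) measurable
  | ACoin i => preimage_set_system setT (racoin X i) measurable
  | BSize i => preimage_set_system setT (rsize X i) measurable
  end.

(* The II-A policy (q, Q): the batch inserted at arrival i is of size         *)
(* rsize X i, distributed as Q, if the coin racoin X i of bias q comes up     *)
(* true, and is empty otherwise.                                              *)
(* The Poisson process is given by its iid exponential interarrival times.    *)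
Record iia_model (lam mu1 mu2 q : R) (Q : probability nat R) X : Prop := IIAModel {
  gap_law : forall i, has_law (rgap X i) (exponential_prob lam);
  wsvc_law : forall i, has_law (rwsvc X i) (exponential_prob mu1);
  bsvc_law : forall i j, has_law (rbsvc X i j) (exponential_prob mu2);
  isvc_law : forall i k, has_law (risvc X i k) (exponential_prob mu2);
  icoin_law : forall i k, has_law (ricoin X i k) (bernoulli_prob q);
  acoin_law : forall i, has_law (racoin X i) (bernoulli_prob q);
  size_law : forall i, has_law (rsize X i) Q;
  sources_indep : mutual_indep P (source_events X) }.

Definition path_H1 X (w : T) : sample_path R := {|
  gap := fun i => rgap X i w;
  wsvc := fun i => rwsvc X i w;
  bsvc := fun i j => rbsvc X i j w;
  isvc := fun i k => risvc X i k w;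
  icoin := fun i k => ricoin X i k w;
  batch := fun i => if racoin X i w then rsize X i w else 0%N |}.

Definition path_H0 X (w : T) : sample_path R := {|
  gap := fun i => rgap X i w;
  wsvc := fun i => rwsvc X i w;
  bsvc := fun i j => rbsvc X i j w;
  isvc := fun i k => risvc X i k w;
  icoin := fun _ _ => false;
  batch := fun _ => 0%N |}.

Definition law_H0 X (n : nat) : set (n.-tuple (record_space R)) -> \bar R :=
  pushforward P (fun w => observation n (path_H0 X w)).

Definition law_H1 X (n : nat) : set (n.-tuple (record_space R)) -> \bar R :=
  pushforward P (fun w => observation n (path_H1 X w)).

Definition mean_inserted X (n : nat) : \bar R :=
  (\int[P]_w inserted (path_H1 X w) n)%E.

End model.

Arguments law_H0 {d T R P} X n.
Arguments law_H1 {d T R P} X n.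

Definition mean_batch (R : realType) (Q : probability nat R) : \bar R :=
  (\sum_(s <oo) s%:R%:E * Q [set s])%E.

(* The infimum over tests of false alarm plus missed detection probabilities; *)
(* a test rejects H0 on the event E.                                          *)
Definition min_error d (O : measurableType d) (R : realType)
    (m0 m1 : set O -> \bar R) : \bar R :=
  ereal_inf [set (m0 E + m1 (~` E))%E | E in measurable].

Definition total_variation d (O : measurableType d) (R : realType)
    (m0 m1 : set O -> \bar R) : \bar R :=
  ereal_sup [set `|m0 E - m1 E|%E | E in measurable].

Lemma min_errorE d (O : measurableType d) (R : realType)
    (m0 m1 : probability O R) :
  min_error m0 m1 = (1 - total_variation m0 m1)%E.
Proof.
have finE0 E : measurable E -> m0 E = (fine (m0 E))%:E.
  by move=> mE; rewrite fineK// fin_num_measure.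
have finE1 E : measurable E -> m1 E = (fine (m1 E))%:E.
  by move=> mE; rewrite fineK// fin_num_measure.
have tvE E : measurable E -> (`|m0 E - m1 E| <= total_variation m0 m1)%E.
  by move=> mE; apply: ereal_sup_ubound; exists E.
have errE E : measurable E ->
    (m0 E + m1 (~` E) = (1 + fine (m0 E) - fine (m1 E))%:E)%E.
  move=> mE; rewrite probability_setC// (finE0 E)// (finE1 E)//=.
  by rewrite -!EFinD; congr _%:E; rewrite addrA (addrC _ 1).
apply/eqP; rewrite eq_le; apply/andP; split; last first.
  apply: le_ereal_inf_tmp => _ [E mE <-].
  apply: (@le_trans _ _ (1 - `|m0 E - m1 E|)%E).
    by apply: leeB => //; exact: tvE.
  rewrite errE// (finE0 E)// (finE1 E)// lee_fin.
  have := ler_norm (fine (m1 E) - fine (m0 E)).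
  by rewrite (distrC (fine (m0 E))) => ?; lra.
have inf_fin : min_error m0 m1 \is a fin_num.
  rewrite ge0_fin_numE.
    apply: (@le_lt_trans _ _ (m0 setT + m1 (~` setT))%E).
      by apply: ereal_inf_lbound; exists setT => //; exact: measurableT.
    by rewrite errE// ltry.
  by apply: le_ereal_inf_tmp => _ [E mE <-]; rewrite adde_ge0// measure_ge0.
have infE E : measurable E ->
    (fine (min_error m0 m1) <= 1 + fine (m0 E) - fine (m1 E)).
  move=> mE; rewrite -lee_fin fineK// -errE//.
  by apply: ereal_inf_lbound; exists E.
rewrite -(fineK inf_fin); set r := fine _ in infE *.
have -> : (r%:E = 1 - (1 - r)%:E)%E by rewrite -EFinB; congr _%:E; lra.
apply: leeB => //; apply: ge_ereal_sup => _ [E mE <-].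
have mCE : measurable (~` E) by exact: measurableC.
have := infE _ mE; have := infE _ mCE.
rewrite !probability_setC// (finE0 E)// (finE1 E)//= lee_fin => *.
by rewrite ler_norml; apply/andP; split; lra.
Qed.

(* Main.v *)
Require Import Defs.
From HB Require Import structures.
From mathcomp Require Import all_boot all_order all_algebra finmap.
From mathcomp Require Import all_classical all_reals all_analysis.
From mathcomp Require Import measurable_realfun lra zify ring.

Set Implicit Arguments.
Unset Strict Implicit.
Unset Printing Implicit Defensive.

Import Order.TTheory GRing.Theory Num.Theory.
Import numFieldNormedType.Exports.

Local Open Scope classical_set_scope.
Local Open Scope ring_scope.

(** Alice is detected by looking at the first job of every W-BP. A W-BP is
    called quick if the reconstructed service time of its first job is at most
    2, and the test rejects H0 when fewer than a threshold number of the first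
    n W-BPs are quick.

    When Alice inserts nothing, the reconstructed service time of a first job
    is its true service time, so a W-BP is quick with probability
    r(0) = 1 - exp(-2 mu1), independently of the past. When she uses the
    policy (q, Q), let W be the sojourn time of the last job before a W-BP, so
    that the W-BP opens when the gap to the next arrival is at least W. By
    memorylessness of that gap, it lies in ]W, W + 1] with a probability
    bounded below. If in addition Alice's coin at the idle instant is up, and
    both the job she would then insert and the first job of her previous batch
    need more than 2 units of time, then, whether or not there was such a
    batch, the server still owes her at least one unit of work when the first
    job arrives. Given the past, all this has a probability proportional to q,
    so that a W-BP is counted as quick with probability at most
    r(q) = r(0) - g q for a constant g > 0 (quick_rate, quick_rateE and
    slow_recon).

    The number of quick W-BPs minus r times the number of opened W-BPs is a
    martingale with bounded increments, hence of order sqrt n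
    (quick_openings_ratio, second_moment_tail). A threshold halfway between
    r(q) n and r(0) n therefore separates the hypotheses as soon as
    sqrt n * q is large (min_error_small). A W-BP that never ends leaves an
    empty record, which is not quick: under H1 this only helps to reject H0,
    and under H0 the first n W-BPs are all completed with a probability close
    to 1.

    It remains to see that T(n) / sqrt n -> oo forces sqrt n * q(n) -> oo.
    This is clear along the n for which q(n) >= q0, a fixed positive constant.
    If q(n) <= q0, each Willie job comes with O(q) insertions on average, and
    the mean number of Willie jobs in n W-BPs is O(n), so T(n) = O(q(n) n)
    (mean_inserted_le). The bound on the number of jobs is a drift argument:
    for q <= q0, the sojourn times decrease on average by a fixed amount from
    one job to the next, except at the openings of W-BPs, where they may
    increase by at most a constant (sojourn_step, drift_path, drift_mean,
    serving_bound). For q = 0 the same bound shows that the W-BPs end under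
    H0. *)

(** * Independence of one source from a set of other sources *)

Section independence.
Context d (T : measurableType d) (R : realType) (P : probability T R).
Context (I : choiceType) (F : I -> set (set T)).
Hypothesis F_meas : forall i, F i `<=` measurable.
Hypothesis F_T : forall i, F i setT.
Hypothesis F_I : forall i, setI_closed (F i).
Hypothesis F_indep : mutual_indep P F.

Let cylinders (A : set I) : set (set T) :=
  [set C | exists J : {fset I}, [set` J] `<=` A /\
     exists2 E : I -> set T, (forall i, F i (E i)) &
       C = \bigcap_(i in [set` J]) E i].

Let cylinders_setI A : setI_closed (cylinders A).
Proof.
move=> _ _ [J1 [J1A [E1 FE1 ->]]] [J2 [J2A [E2 FE2 ->]]].
pose E i := (if i \in J1 then E1 i else setT) `&` (if i \in J2 then E2 i else setT).
exists (J1 `|` J2)%fset; split.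
  by move=> i /=; rewrite in_fsetU => /orP[/J1A|/J2A].
exists E.
  by move=> i; apply: F_I; case: ifP.
apply/seteqP; split=> [w [w1 w2] i /= _|w Ew].
  by split; case: ifPn => // ii; [exact: w1|exact: w2].
split=> i /= ii.
  by have := Ew i; rewrite /= /E in_fsetU ii => /(_ isT)[].
by have := Ew i; rewrite /= /E in_fsetU ii orbT => /(_ isT)[_ ?].
Qed.

(** The collection of H for which the identity holds is a lambda-system; by the
    definition of mutual independence it contains the finite intersections of
    events of the F j with j in A, which form a pi-system generating the
    sigma-algebra of the families in A. *)
Lemma mutual_indep_sigma (A : set I) (i : I) (E H : set T) :
  ~ A i -> F i E -> <<s \bigcup_(j in A) F j >> H ->
  P (H `&` E) = (P H * P E)%E.
Proof.
move=> nAi FE sH.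
have mE : measurable E := F_meas FE.
pose a : {nonneg R} := NngNum (fine_ge0 (measure_ge0 P E)).
pose m1 := mrestr P mE.
pose m2 := mscale a P.
have aE : (a%:num)%:E = P E by rewrite /a /= fineK// fin_num_measure.
suff : m1 H = m2 H.
  by rewrite /m1 /m2 /mrestr /= /mscale /= -/a aE muleC.
apply: (g_sigma_algebra_measure_unique (cylinders A) _ (fun=> setT)) => //.
- move=> _ [K [_ [E' FE' ->]]].
  apply: fin_bigcap_measurable; first exact: finite_fset.
  by move=> j _; exact: F_meas.
- move=> _; exists fset0; split => //.
  exists (fun=> setT) => //.
  by apply/seteqP; split.
- by rewrite bigcup_const//; exists 0%N.
- move=> _ [K [KA [E' FE' ->]]].
  rewrite /m1 /m2 /mrestr /= /mscale /= aE.
  rewrite (F_indep (E := E')); last by move=> j _; exact: FE'.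
  rewrite /mrestr /=.
  have iK : i \notin K by apply/negP => /KA.
  have neq j : j \in K -> j != i by apply: contraTneq => ->.
  pose E2 j := if j == i then E else E' j.
  have -> : \bigcap_(j in [set` K]) E' j `&` E =
      \bigcap_(j in [set` (i |` K)%fset]) E2 j.
    apply/seteqP; split=> [w [w1 w2] j /=|w Ew].
      by rewrite in_fset1U /E2; case: eqP => //= _ /w1.
    split=> [j /= jK|].
      by have := Ew j; rewrite /= in_fset1U /E2 jK orbT (negbTE (neq _ jK)); apply.
    by have := Ew i; rewrite /= in_fset1U /E2 eqxx; apply.
  rewrite (F_indep (E := E2)); last first.
    by move=> j; rewrite in_fset1U /E2; case: eqP => [->|].
  rewrite big_fsetU1//= /E2 eqxx; congr (_ * _)%E.
  by rewrite !big_seq; apply: eq_bigr => j jK; rewrite (negbTE (neq _ jK)).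
- by move=> _; rewrite /mrestr (le_lt_trans (probability_le1 _ _)) ?ltry//; exact:
  measurableI.
- move: sH; apply: sub_smallest2r => // B [j Aj FB].
  exists [fset j]%fset; split; first by move=> k /=; rewrite in_fset1 => /eqP ->.
  exists (fun k => if k == j then B else setT).
    by move=> k; case: eqP => // ->.
  by rewrite set_fset1 bigcap_set1 eqxx.
Qed.

End independence.

(** * Exponential and Bernoulli laws *)

Lemma measurable_pred d (T : measurableType d) (b : T -> bool) :
  measurable_fun setT b -> measurable [set w | b w].
Proof.
by move=> mb; rewrite -[X in measurable X]setTI; exact: mb.
Qed.

Lemma bernoulli_law_true d (T : measurableType d) (R : realType)
    (P : probability T R) (p : R) (Y : {RV P >-> bool}) :
  0 <= p <= 1 -> has_law Y (bernoulli_prob p) -> P [set w | Y w] = p%:E.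
Proof.
move=> p01 Y_law; have -> : [set w | Y w] = Y @^-1` [set true].
  by apply/seteqP; split.
rewrite -[LHS]/(distribution P Y [set true]) Y_law//.
rewrite bernoulli_probE// !diracE mem_set//= memNset//=.
by rewrite mule1 mule0 adde0.
Qed.

Section exponential_law.
Context d (T : measurableType d) (R : realType) (P : probability T R).
Variables (rate : R) (X : {RV P >-> R}).
Hypothesis X_law : has_law X (exponential_prob rate).

Local Notation m := (distribution P X).

Let mE A : measurable A -> m A = exponential_prob rate A.
Proof. exact: X_law. Qed.

Lemma exponential_neg : P [set w | X w < 0] = 0%E.
Proof.
have -> : [set w | X w < 0] = X @^-1` `]-oo, 0[%classic.
  by apply/seteqP; split=> w /=; rewrite in_itv.
rewrite -[LHS]/(m _) mE; last exact: measurable_itv.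
rewrite /exponential_prob; apply: integral0_eq => x /=.
by rewrite in_itv/= => /lt0_exponential_pdf ->.
Qed.

Let atom x : m [set x] = 0%E.
Proof. by rewrite mE// /exponential_prob integral_set1. Qed.

Lemma exponential_tail x : 0 <= x ->
  P [set w | x < X w] = (expR (- rate * x))%:E.
Proof.
have gt0_case y : 0 < y -> m `]y, +oo[%classic = (expR (- rate * y))%:E.
  move=> y0; have : m setT = 1%E by exact: probability_setT.
  have -> : [set: R] = `]-oo, 0[ `|` (`[0, y] `|` `]y, +oo[).
    apply/seteqP; split=> // z _ /=; rewrite !in_itv/= andbT.
    case: (ltP z 0); first by left.
    by move=> z0; right; case: (leP z y); [left|right].
  rewrite measureU//=; last 2 first.
  - by apply: measurableU; exact: measurable_itv.
  - apply/seteqP; split=> // z /=; rewrite !in_itv/= !andbT => -[z0].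
    by case=> [/andP[]|] ?; lra.
  rewrite measureU//=; last first.
    by apply/seteqP; split=> // z /=; rewrite !in_itv/= !andbT => -[/andP[] ? ? ?]; lra.
  have -> : m `]-oo, 0[%classic = 0%E.
    by rewrite -exponential_neg; apply: (congr1 P); apply/seteqP; split=> w /=;
      rewrite in_itv.
  have -> : m `[0, y]%classic = (1 - (expR (- rate * y))%:E)%E.
    by rewrite mE ?exponential_prob_itv0c//; exact: measurable_itv.
  rewrite add0e.
  rewrite -[m `]y, +oo[%classic]fineK ?fin_num_measure//.
  by rewrite -EFinB -EFinD => -[] h; congr _%:E; lra.
move=> x0; have -> : [set w | x < X w] = X @^-1` `]x, +oo[%classic.
  by apply/seteqP; split=> w /=; rewrite in_itv/= andbT.
move: x0; rewrite le_eqVlt => /predU1P[<-|/gt0_case//].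
rewrite mulr0 expR0.
have : m setT = 1%E by exact: probability_setT.
have -> : [set: R] = `]-oo, 0[ `|` ([set 0] `|` `]0, +oo[).
  apply/seteqP; split=> // z _ /=; rewrite !in_itv/= andbT.
  by case: (ltrgtP z 0) => h; [left|right; right|right; left].
rewrite measureU//=; last 2 first.
- by apply: measurableU => //; exact: measurable_itv.
- apply/seteqP; split=> // z /=; rewrite !in_itv/= !andbT => -[z0].
  by case=> ?; lra.
rewrite measureU//=; last first.
  by apply/seteqP; split=> // z /=; rewrite !in_itv/= !andbT => -[-> ?]; lra.
have -> : m `]-oo, 0[%classic = 0%E.
  by rewrite -exponential_neg; apply: (congr1 P); apply/seteqP; split=> w /=;
    rewrite in_itv.
by rewrite atom !add0e.
Qed.

Lemma exponential_tail_le x : 0 <= x ->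
  P [set w | x <= X w] = (expR (- rate * x))%:E.
Proof.
move=> x0; rewrite -exponential_tail//.
have -> : [set w | x <= X w] = X @^-1` [set x] `|` [set w | x < X w].
  apply/seteqP; split=> [w /=|w /= [->//|/ltW//]].
  by rewrite le_eqVlt => /predU1P[->|]; [left|right].
rewrite measureU//.
- by rewrite [X in (X + _)%E](_ : _ = 0%E) ?add0e//; exact: atom.
- have -> : [set w | x < X w] = X @^-1` `]x, +oo[%classic.
    by apply/seteqP; split=> w /=; rewrite in_itv/= andbT.
  by apply: measurable_funPTI; exact: measurable_itv.
- by apply/seteqP; split=> // w /= [->]; rewrite ltxx.
Qed.

Lemma exponential_oc x y : 0 <= x -> x <= y ->
  P [set w | x < X w <= y] = (expR (- rate * x) - expR (- rate * y))%:E.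
Proof.
move=> x0 xy.
have tailE z : [set w | z < X w] = X @^-1` `]z, +oo[%classic.
  by apply/seteqP; split=> w /=; rewrite in_itv/= andbT.
have mtail z : measurable [set w | z < X w].
  by rewrite tailE -[X in measurable X]setTI; apply: measurable_funP => //; exact:
    measurable_itv.
have -> : [set w | x < X w <= y] = [set w | x < X w] `\` [set w | y < X w].
  apply/seteqP; split=> w /=; first by move=> /andP[? ?]; split=> //; apply/negP;
    rewrite -leNgt.
  by move=> [-> /negP]; rewrite -leNgt.
rewrite measureD//; last by rewrite (le_lt_trans (probability_le1 _ _)) ?ltry.
rewrite setIidr; last by move=> w /=; exact: le_lt_trans.
by rewrite EFinB -(exponential_tail x0) -(exponential_tail (le_trans x0 xy)).
Qed.

End exponential_law.

Section memoryless.
Context d (T : measurableType d) (R : realType) (P : probability T R).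
Variables (rate : R) (Z X : {RV P >-> R}).
Hypothesis rate_gt0 : 0 < rate.
Hypothesis X_law : has_law X (exponential_prob rate).
Hypothesis ZX_indep : forall A B, measurable A -> measurable B ->
  P (Z @^-1` A `&` X @^-1` B) = (P (Z @^-1` A) * P (X @^-1` B))%E.

Let ZX w := (Z w, X w).
Let mZX : measurable_fun setT ZX.
Proof. exact: measurable_fun_pair. Qed.
#[local] HB.instance Definition _ := isMeasurableFun.Build _ _ _ _ ZX mZX.

Let joint (S : set (R * R)) : measurable S ->
  P (ZX @^-1` S) = (\int[distribution P Z]_z P (X @^-1` (xsection S z)))%E.
Proof.
move=> mS.
rewrite -[LHS]/(distribution P ZX S).
rewrite -(product_measure_unique (m1 := distribution P Z) (m2 := distribution P X))//.
Qed.

(** The joint law of Z and X is the product of their laws, so both sides are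
    integrals over the law of Z; at a value z >= 0 the integrands are
    exp(-rate z) - exp(-rate (z + K)) and exp(-rate z). Negative values of Z
    serve to encode a further event. *)
Lemma memoryless (K : R) : 0 <= K ->
  P [set w | 0 <= Z w /\ Z w < X w <= Z w + K] =
  ((1 - expR (- rate * K))%:E * P [set w | (0 <= Z w <= X w)%R])%E.
Proof.
move=> K0.
pose S1 : set (R * R) := [set p | 0 <= p.1] `&` ([set p | p.1 < p.2] `&` [set p | p.2 <=
  p.1 + K]).
pose S2 : set (R * R) := [set p | 0 <= p.1] `&` [set p | p.1 <= p.2].
have mf : measurable_fun setT (fst : R * R -> R) by [].
have ms : measurable_fun setT (snd : R * R -> R) by [].
have mp : measurable [set p : R * R | 0 <= p.1].
  exact/measurable_pred/measurable_fun_ler.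
have mS1 : measurable S1.
  apply: measurableI => //; apply: measurableI.
    exact/measurable_pred/measurable_fun_ltr.
  apply/measurable_pred/measurable_fun_ler => //.
  exact: measurable_funD.
have mS2 : measurable S2.
  apply: measurableI => //.
  exact/measurable_pred/measurable_fun_ler.
have -> : [set w | 0 <= Z w /\ Z w < X w <= Z w + K] = ZX @^-1` S1.
  by apply/seteqP; split=> w /=; [move=> [? /andP[]]|move=> [? [-> ->]]].
have -> : [set w | 0 <= Z w <= X w] = ZX @^-1` S2.
  by apply/seteqP; split=> w /=; [move=> /andP[]|move=> [-> ->]].
rewrite !joint// -ge0_integralZl//; last 2 first.
- exact: (measurable_fun_xsection (distribution P X)).
- by rewrite lee_fin subr_ge0 expR_le1 mulNr oppr_le0 mulr_ge0// ltW.
apply: eq_integral => z _.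
have [z0|z0] := ltP z 0.
  have -> : xsection S1 z = set0.
    by apply/seteqP; split=> // x; rewrite /xsection/= inE => -[/=]; lra.
  have -> : xsection S2 z = set0.
    by apply/seteqP; split=> // x; rewrite /xsection/= inE => -[/=]; lra.
  by rewrite preimage_set0 measure0 mule0.
have -> : X @^-1` xsection S1 z = [set w | z < X w <= z + K].
  apply/seteqP; split=> w /=; rewrite /xsection/= inE/=.
    by move=> [_ [/= -> ->]].
  by move=> /andP[? ?].
have -> : X @^-1` xsection S2 z = [set w | z <= X w].
  by apply/seteqP; split=> w /=; rewrite /xsection/= inE/=; [case|].
rewrite (exponential_oc X_law)//; last by rewrite lerDl.
rewrite (exponential_tail_le X_law)// -EFinM; congr _%:E.
by rewrite mulrDr expRD; ring.
Qed.
End memoryless.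

(** * The W-BPs of a sample path *)

Section wbp_structure.
Context (R : realType) (s : sample_path R).
Local Notation idx := (wbp_index s).

(** The case i = 0 reflects that the queue is empty at time 0. *)
Definition opens_wbp (i : nat) : bool :=
  if i is i'.+1 then departure s i' <= arrival s i else true.

Lemma wbp_index0 : idx 0 = 0%N.
Proof. by rewrite /wbp_index big_ord0. Qed.

Lemma wbp_indexS i : idx i.+1 = (idx i + opens_wbp i.+1)%N.
Proof. by rewrite /wbp_index big_ord_recr. Qed.

Lemma wbp_index_homo : {homo idx : i k / (i <= k)%N}.
Proof.
by apply: homo_leq => [//|y x z|i]; [exact: leq_trans|rewrite wbp_indexS leq_addr].
Qed.

(** The indices increase by at most 1 from job to job, so that the jobs of a
    W-BP are consecutive. The W-BPs before the j-th are finite as soon as some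
    job has index at least j, and then their sizes add up to the first job of
    the j-th. *)
Lemma wbp_firstP j m : (j <= idx m)%N ->
  forall i, (idx i < j)%N = (i < wbp_first s j)%N.
Proof.
elim: j => [|j IH] jm.
  by move=> i; rewrite /wbp_first big_ord0 !ltn0.
have {}IH := IH (ltnW jm).
(* N is the first job of W-BP j.+1. *)
have [N idxN minN] : exists2 N, (j < idx N)%N & forall i, (j < idx i)%N -> (N <= i)%N.
  have ex : exists i, (j < idx i)%N by exists m.
  by case: (ex_minnP ex) => N; exists N.
have NE i : (idx i <= j)%N = (i < N)%N.
  apply/idP/idP => [ij|iN].
    rewrite ltnNge; apply/negP => /wbp_index_homo Ni.
    by move: (leq_trans idxN Ni); rewrite ltnNge ij.
  by rewrite leqNgt; apply/negP => /minN; rewrite leqNgt iN.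
have fN : (wbp_first s j <= N)%N.
  case E : (wbp_first s j) => [//|k].
  by rewrite -NE ltnW// IH E.
have AE : [set i | idx i = j] =
  [set` [fset i in iota (wbp_first s j) (N - wbp_first s j)]%fset].
  apply/seteqP; split=> i /=; rewrite !inE/= mem_iota subnKC// -NE.
    by move=> ij; rewrite ij leqnn andbT leqNgt -IH ij ltnn.
  by rewrite leqNgt -IH -leqNgt => /andP[? ?]; apply/eqP; rewrite eqn_leq; apply/andP.
have sz : wbp_size s j = (N - wbp_first s j)%N.
  rewrite /wbp_size AE set_fsetK card_fseq undup_id ?iota_uniq// size_iota//.
move=> i; rewrite /wbp_first big_ord_recr/= -/(wbp_first s j) sz subnKC//.
by rewrite ltnS NE.
Qed.

Lemma wbp_sizeE j m : (j < idx m)%N ->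
  (0 < wbp_size s j)%N /\ idx (wbp_first s j) = j.
Proof.
move=> jm; have H1 := wbp_firstP jm; have H2 := wbp_firstP (ltnW jm).
have fS : wbp_first s j.+1 = (wbp_first s j + wbp_size s j)%N.
  by rewrite /wbp_first big_ord_recr.
have idxfj : idx (wbp_first s j) = j.
  apply/eqP; rewrite eqn_leq [X in _ && X]leqNgt H2 ltnn andbT.
  case E : (wbp_first s j) => [|k]; first by rewrite wbp_index0.
  have : (idx k < j)%N by rewrite H2 E.
  rewrite wbp_indexS => kj; apply: leq_trans kj.
  by case: opens_wbp; rewrite ?addn1 ?addn0.
split=> //; have := H1 (wbp_first s j).
by rewrite idxfj ltnSn fS -[X in (X < _)%N]addn0 ltn_add2l => <-.
Qed.

Lemma opens_wbp_first i : opens_wbp i -> forall m, (idx i < idx m)%N ->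
  i = wbp_first s (idx i).
Proof.
move=> oi m im; have H := wbp_firstP (ltnW im).
apply/eqP; rewrite eqn_leq [X in _ && X]leqNgt -H ltnn andbT.
case: i oi im H => [//|i] oi im H.
by rewrite -H wbp_indexS oi addn1 ltnSn.
Qed.

Lemma size_wbp_record j : size (wbp_record s j) = wbp_size s j.
Proof. by rewrite size_map size_iota. Qed.

(** If no job has an index above j, the set of jobs of index j is empty or
    infinite, and its size is 0 in both cases. *)
Lemma wbp_size_gt0 j : (0 < wbp_size s j)%N ->
  exists2 m, (j < idx m)%N & idx (wbp_first s j) = j.
Proof.
move=> sz; suff [m jm] : exists m, (j < idx m)%N.
  by exists m => //; have [] := wbp_sizeE jm.
apply: contrapT => /forallNP noidx.
have le i : (idx i <= j)%N by rewrite leqNgt; apply/negP/noidx.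
have [fin|inf] := pselect (finite_set [set i | idx i = j]); last first.
  by move: sz; rewrite /wbp_size /fset_set; case: pselect; rewrite ?cardfs0.
have [i0 ij] : exists i, idx i = j.
  apply: contrapT => /forallNP no.
  move: sz; rewrite /wbp_size (_ : [set i | idx i = j] = set0) ?fset_set0 ?cardfs0//.
  by apply/seteqP; split=> i //= /no.
move: fin => /finite_seqP[r rE].
have : idx (\max_(i <- r) i + i0).+1 = j.
  apply/eqP; rewrite eqn_leq le/= -ij; apply: wbp_index_homo.
  by rewrite -addnS (leq_trans (leqnSn _))// leq_addl.
move=> ij1; have : [set i | idx i = j] (\max_(i <- r) i + i0).+1 by [].
rewrite rE/= => /(@leq_bigmax_seq _ r xpredT id _) /(_ isT).
by rewrite ltnNge leq_addr.
Qed.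

(** Only a finished W-BP has a nonempty record, hence the index m. *)
Lemma wbp_head_started j : (0 < size (wbp_record s j))%N ->
  exists i m, [/\ opens_wbp i, idx i = j, (j < idx m)%N &
    nth (0, 0) (wbp_record s j) 0 = (arrival s i, recon s i)].
Proof.
rewrite size_wbp_record => sz; have [m jm idxj] := wbp_size_gt0 sz.
exists (wbp_first s j), m; split => //.
  case E : (wbp_first s j) => [//|i].
  have : (idx i < j)%N by rewrite (wbp_firstP (ltnW jm)) E.
  rewrite -[X in (_ < X)%N]idxj E wbp_indexS.
  by case: opens_wbp => //; rewrite addn0 ltnn.
rewrite /wbp_record (nth_map 0%N) ?size_iota// nth_iota// addn0//.
Qed.

Lemma wbp_head_record i m : opens_wbp i -> (idx i < idx m)%N ->
  (0 < size (wbp_record s (idx i)))%N /\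
  nth (0, 0) (wbp_record s (idx i)) 0 = (arrival s i, recon s i).
Proof.
move=> oi im; rewrite size_wbp_record; have [sz _] := wbp_sizeE im.
split=> //; rewrite /wbp_record (nth_map 0%N) ?size_iota// nth_iota// addn0.
by rewrite -(opens_wbp_first oi im).
Qed.

End wbp_structure.

(** * Pathwise drift of the sojourn times *)

Section idle_insertions.
Context (R : realType) (e a : R) (c : nat -> bool) (z : nat -> R).
Hypothesis z_ge0 : forall k, 0 <= z k.

Lemma idle_insertW k l : (l <= k)%N -> idle_insert e a c z k -> idle_insert e a c z l.
Proof.
move=> lk /forallP h; apply/forallP => j.
have jk : (j < k.+1)%N by rewrite (leq_trans (ltn_ord j)).
by have := h (Ordinal jk).
Qed.

Definition coins_up (k : nat) := [forall j : 'I_k.+1, c j].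

Lemma idle_insert_coins k : idle_insert e a c z k -> coins_up k.
Proof. by move=> /forallP h; apply/forallP => j; have /andP[] := h j. Qed.

Lemma coins_upS k : coins_up k.+1 = coins_up k && c k.+1.
Proof.
apply/forallP/andP => [h|[/forallP h ck] j].
  split; last exact: (h ord_max).
  by apply/forallP => j; have := h (widen_ord (leqnSn _) j).
have [jk|jk] := ltnP j k.+1; first exact: (h (Ordinal jk)).
suff -> : j = k.+1 :> nat by [].
by apply/eqP; rewrite eqn_leq jk -ltnS ltn_ord.
Qed.

(** An upper bound on the work inserted at the idle instants between two
    jobs, in which every insertion is served regardless of the next arrival. It
    depends on the coins and services only, and not on the past. *)
Definition idle_load : \bar R :=
  (\sum_(k <oo) (if coins_up k then z k else 0)%:E)%E.

Local Notation u := (fun m => e + \sum_(0 <= k < m | idle_insert e a c z k) z k).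

Let u_nd : nondecreasing_seq u.
Proof.
apply/nondecreasing_seqP => m; rewrite lerD2l big_mkcond [leRHS]big_mkcond/=.
by rewrite big_nat_recr//= lerDl; case: ifP.
Qed.

(** Either all insertions take place, and then the partial sums stay below a,
    or the partial sums are eventually constant. *)
Let u_cvg : cvgn u.
Proof.
have [all_in|] := pselect (forall k, idle_insert e a c z k).
  apply: nondecreasing_is_cvgn => //; exists a => _ [m _ <-].
  have /forallP/(_ ord_max)/andP[_ /ltW] := all_in m.
  apply: le_trans; rewrite lerD2l big_mkcond/= big_mkord.
  by apply: ler_sum => k _; case: ifP.
move=> /existsNP[k /negP nk].
apply/cvg_ex; exists (u k); apply: (@cvg_near_cst _ _ _ _ _ _ _).
near=> m; congr (_ + _).
have km : (k <= m)%N by near: m; exists k.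
rewrite big_mkcond [RHS]big_mkcond (big_cat_nat (leq0n k) km)//=.
rewrite [X in _ + X = _]big_nat_cond [X in _ + X = _]big1 ?addr0// =>
  l /andP[/andP[kl _] _].
by case: ifPn => // /(idle_insertW kl); rewrite (negbTE nk).
Unshelve. all: by end_near. Qed.

Lemma idle_done_ge : e <= idle_done e a c z.
Proof.
have := nondecreasing_cvgn_le u_nd u_cvg 0%N.
by rewrite big_nil addr0.
Qed.

Lemma idle_done_ge1 : c 0%N -> e < a -> e + z 0 <= idle_done e a c z.
Proof.
move=> c0 ea; have := nondecreasing_cvgn_le u_nd u_cvg 1%N.
rewrite big_mkcond big_nat1 ifT//.
by apply/forallP => -[[|//] /= _]; rewrite big_ord0 addr0 c0.
Qed.

Lemma idle_done_load : ((idle_done e a c z)%:E <= e%:E + idle_load)%E.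
Proof.
have load0 : (0 <= idle_load)%E.
  by apply: nneseries_ge0 => k _ _; rewrite lee_fin; case: ifP.
case E : idle_load load0 => [l| |] // _; last by rewrite leey.
rewrite -EFinD lee_fin; apply: limr_le => //; apply: nearW => m.
rewrite lerD2l -lee_fin -E /idle_load.
apply: le_trans (nneseries_lim_ge m _); last first.
  by move=> k _ _; rewrite lee_fin; case: ifP.
rewrite sumEFin lee_fin /=.
rewrite big_mkcond/=; apply: ler_sum => k _.
by case: ifPn => [/idle_insert_coins ->//|_]; case: ifP.
Qed.

Lemma idle_done_nocoin : c 0%N = false -> idle_done e a c z = e.
Proof.
move=> c0; apply: cvg_lim => //.
rewrite (_ : u = cst e); first exact: cvg_cst.
apply/funext => m; rewrite big1 ?addr0// => k /(idle_insertW (leq0n _)).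
by move=> /idle_insert_coins/forallP/(_ ord0); rewrite c0.
Qed.

End idle_insertions.

Section sample_path_inequalities.
Context (R : realType) (s : sample_path R).
Local Notation idx := (wbp_index s).

Definition nonneg_path := [/\ forall i, 0 <= gap s i, forall i, 0 <= wsvc s i,
  forall i j, 0 <= bsvc s i j & forall i k, 0 <= isvc s i k].

Definition sojourn i : R := departure s i - arrival s i.

Definition batch_load i : R := \sum_(j < batch s i) bsvc s i j.

Hypothesis s_ge0 : nonneg_path.

Lemma departure_ge i : arrival s i + wsvc s i <= departure s i.
Proof. by rewrite /departure /serve lerD2r le_max lexx. Qed.

Lemma sojourn_ge0 i : 0 <= sojourn i.
Proof.
rewrite subr_ge0; apply: le_trans (departure_ge i).
by rewrite lerDl; have [_ ->] := s_ge0.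
Qed.

Lemma batch_load_ge0 i : 0 <= batch_load i.
Proof. by apply: sumr_ge0 => j _; have [_ _ ->] := s_ge0. Qed.

Lemma arrivalS i : arrival s i.+1 = arrival s i + gap s i.+1.
Proof. by rewrite /arrival big_ord_recr. Qed.

Definition idle_load_at i := idle_load (icoin s i) (isvc s i).

Lemma idle_load_at_ge0 i : (0 <= idle_load_at i)%E.
Proof.
by apply: nneseries_ge0 => k _ _; rewrite lee_fin; case: ifP => // _; have [_ _ _ ->] :=
  s_ge0.
Qed.

(** When job i.+1 opens a W-BP, job i has left before it arrives and its
    sojourn time contributes 0 instead of decreasing by the whole gap. The
    truncation of the gap at K keeps this correction bounded. *)
Lemma sojourn_step K i : 0 <= K ->
  ((sojourn i.+1 + Num.min (gap s i.+1) K)%:E <=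
   (sojourn i + K * (opens_wbp s i.+1)%:R)%:E +
   ((wsvc s i.+1 + batch_load i)%:E + idle_load_at i.+1))%E.
Proof.
move=> K0.
have := @idle_done_load _ (clear s i.+1) (arrival s i.+1) (icoin s i.+1) (isvc s i.+1) _.
have [g0 w0 b0 i0] := s_ge0 => /(_ (i0 _)).
rewrite -/(idle_load_at i.+1).
have := idle_load_at_ge0 i.+1.
case: idle_load_at => [l| |]// l0; last by rewrite !addey ?leey.
rewrite -!EFinD !lee_fin => dl.
have ge0 := sojourn_ge0 i; have bl0 := batch_load_ge0 i.
have ge := arrivalS i.
have gi := g0 i.+1; have wi := w0 i.+1.
rewrite lee_fin in l0.
have clE : clear s i.+1 = departure s i + batch_load i by [].
move: dl; rewrite /sojourn [departure s i.+1]/departure /serve clE /sojourn => dl.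
rewrite /sojourn in ge0.
rewrite /opens_wbp; case: (leP (departure s i) (arrival s i.+1)) => oi /=;
  rewrite ?mulr1 ?mulr0 ?addr0.
all: rewrite maxEle minEle; case: ifPn => c1; case: ifPn => c2;
  rewrite -?ltNge in c1 c2; lra.
Qed.

Lemma sojourn0 : ((sojourn 0)%:E <= (wsvc s 0)%:E + idle_load_at 0)%E.
Proof.
have := @idle_done_load _ 0 (arrival s 0) (icoin s 0) (isvc s 0) _.
have [g0 w0 b0 i0] := s_ge0 => /(_ (i0 _)).
rewrite -/(idle_load_at 0) add0e.
have := idle_load_at_ge0 0.
case: idle_load_at => [l| |]// l0; last by rewrite addey ?leey.
rewrite -!EFinD !lee_fin => dl.
rewrite lee_fin in l0.
have a0 : 0 <= arrival s 0 by rewrite /arrival big_ord_recr big_ord0/= add0r.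
rewrite /sojourn /departure /serve /= maxEle; case: ifPn => c1; rewrite -?ltNge in c1;
  lra.
Qed.

(** The sum of sojourn_step over the jobs of the first n W-BPs: the sojourn
    times telescope, and at most n of the jobs open a W-BP. *)
Lemma drift_path K n m : 0 <= K ->
  (\sum_(i < m) (if (idx i < n)%N then Num.min (gap s i.+1) K else 0)%:E <=
   ((wsvc s 0)%:E + idle_load_at 0) + (K * n%:R)%:E +
   \sum_(i < m) (if (idx i < n)%N then (wsvc s i.+1 + batch_load i)%:E + idle_load_at i.+1
      else 0))%E.
Proof.
move=> K0.
suff : (\sum_(i < m) (if (idx i < n)%N then Num.min (gap s i.+1) K else 0)%:E
    + (if (idx m < n)%N then sojourn m else 0)%:E <=
   ((wsvc s 0)%:E + idle_load_at 0) + (K * (minn (idx m) n)%:R)%:E +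
   \sum_(i < m) (if (idx i < n)%N then (wsvc s i.+1 + batch_load i)%:E + idle_load_at i.+1
      else 0))%E.
  move=> h; apply: le_trans (le_trans h _).
    by rewrite leeDl// lee_fin; case: ifP => // _; exact: sojourn_ge0.
  rewrite leeD2r// leeD2l// lee_fin ler_wpM2l// ler_nat geq_minr//.
have Y0 i : (0 <= (wsvc s i.+1 + batch_load i)%:E + idle_load_at i.+1)%E.
  rewrite adde_ge0 ?idle_load_at_ge0// lee_fin addr_ge0 ?batch_load_ge0//.
  by have [_ ->] := s_ge0.
elim: m => [|m IH].
  rewrite !big_ord0 add0e adde0 wbp_index0 min0n mulr0 adde0.
  case: ifP => _; first exact: sojourn0.
  rewrite adde_ge0 ?idle_load_at_ge0// lee_fin.
  by have [_ ->] := s_ge0.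
rewrite !big_ord_recr/=; case: ifPn IH => [idxm|].
  move=> IH.
  have idxS : minn (idx m.+1) n = (minn (idx m) n + opens_wbp s m.+1)%N.
    rewrite wbp_indexS; move: idxm; case: opens_wbp; rewrite ?addn1 ?addn0// => mn.
    by rewrite (minn_idPl mn) (minn_idPl (ltnW mn)).
  rewrite idxS natrD mulrDr EFinD sumEFin in IH *.
  set S := \sum_(i < m) _ in IH *; set Y := (_ + idle_load_at m.+1)%E.
  apply: (@le_trans _ _ (S%:E + (sojourn m.+1 + Num.min (gap s m.+1) K)%:E)%E).
    rewrite -!EFinD lee_fin.
    by case: ifP => _; have := sojourn_ge0 m.+1; lra.
  apply: (le_trans (leeD2l _ (sojourn_step m K0))); rewrite -/Y.
  rewrite !EFinD [leRHS](_ : _ = (wsvc s 0)%:E + idle_load_at 0 +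
      (K * (minn (idx m) n)%:R)%:E + (\sum_(i < m)
        (if (idx i < n)%N then (wsvc s i.+1 + batch_load i)%:E + idle_load_at i.+1
         else 0))%R + ((K * (opens_wbp s m.+1)%:R)%:E + Y))%E; last first.
    by rewrite (addeA ((wsvc s 0)%:E + idle_load_at 0)%E) addeACA.
  have -> : (S%:E + ((sojourn m)%:E + (K * (opens_wbp s m.+1)%:R)%:E + Y) =
      S%:E + (sojourn m)%:E + ((K * (opens_wbp s m.+1)%:R)%:E + Y))%E.
    by rewrite -!addeA.
  exact: leeD2r.
rewrite -leqNgt => nm; rewrite !adde0 => IH.
have nm1 : (n <= idx m.+1)%N by rewrite (leq_trans nm)// wbp_index_homo.
rewrite ltnNge nm1/= adde0.
by move: IH; rewrite (minn_idPr nm) (minn_idPr nm1).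
Qed.

End sample_path_inequalities.

(** * First jobs of W-BPs that Alice delays *)

Section slow_first_jobs.
Context (R : realType) (s : sample_path R).
Local Notation idx := (wbp_index s).

(** Job i.+1 opens a W-BP when the gap before it is at least prev_sojourn, a
    quantity determined by the sources preceding that gap. *)
Definition prev_sojourn i : R := if i is i'.+1 then sojourn s i' else 0.

(** The index of the W-BP that job i opens, if it opens one. *)
Definition next_wbp i : nat := if i is i'.+1 then (idx i').+1 else 0%N.

Definition opening n i : bool :=
  (next_wbp i < n)%N && (0 <= prev_sojourn i <= gap s i).

(** For i > 0 this is the first job of the batch preceding job i. Before job 0
    there is no batch, and an independent service time of the same law stands
    for it, so that blocked has the same conditional probability for all i. *)
Definition spare_svc i : R := if i is i'.+1 then bsvc s i' 0 else isvc s 0 1.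

(** A sufficient condition for job i, if it opens a W-BP, to find at least
    one unit of Alice's work in front of it. If the preceding batch is
    nonempty, its first job keeps the server busy until one unit of time after
    the arrival of job i; otherwise the server idles before that arrival and
    the job inserted at this idle instant does. *)
Definition blocked i : bool :=
  [&& icoin s i 0, 2 < isvc s i 0, 2 < spare_svc i &
      prev_sojourn i < gap s i <= prev_sojourn i + 1].

(** For a first job, a part of the event that the reconstructed service time
    exceeds 2: the service time exceeds 2, or it exceeds 1 and one unit of
    Alice's work is added to it. *)
Definition slow i : bool := (2 < wsvc s i) || (1 < wsvc s i) && blocked i.

Definition quick_opening n i : bool := opening n i && ~~ slow i.

Definition quick_record (r : seq (R * R)) : bool :=
  (0 < size r)%N && ((nth (0, 0) r 0).2 <= 2).

Definition quick_count n : nat := (\sum_(j < n) quick_record (wbp_record s j))%N.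

Lemma opens_wbpS i : opens_wbp s i.+1 = (sojourn s i <= gap s i.+1).
Proof. by rewrite /opens_wbp arrivalS /sojourn lerBlDl. Qed.

Lemma opening_opens n i : opening n i -> opens_wbp s i /\ idx i = next_wbp i.
Proof.
case: i => [|i]; first by rewrite wbp_index0.
by rewrite /opening wbp_indexS opens_wbpS => /and3P[_ _ /= ->]; rewrite addn1.
Qed.

(** Different jobs open different W-BPs. *)
Lemma sum_opening n m : (\sum_(i < m) opening n i <= n)%N.
Proof.
suff : (\sum_(i < m.+1) opening n i <= minn (idx m).+1 n)%N.
  rewrite big_ord_recr/= leq_min => /andP[_].
  by apply: leq_trans; exact: leq_addr.
elim: m => [|m IH].
  rewrite big_ord_recr big_ord0/= add0n wbp_index0 leq_min leq_b1/=.
  by have [->|n0] := posnP n; [rewrite /opening ltn0|rewrite (leq_trans (leq_b1 _))].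
rewrite big_ord_recr/=; have [om|_] := boolP (opening n m.+1); last first.
  rewrite addn0 (leq_trans IH)// leq_min geq_minr andbT geq_min.
  by rewrite ltnS wbp_index_homo.
have [_ ->] := opening_opens om.
rewrite addn1 leq_min; apply/andP; split.
  by rewrite ltnS (leq_trans IH)// geq_minl.
move: om => /andP[/= om _].
by rewrite (leq_ltn_trans IH)//; apply: leq_ltn_trans (geq_minl _ _) _.
Qed.

Hypothesis s_ge0 : nonneg_path s.

Lemma openingE n i : opening n i = opens_wbp s i && (idx i < n)%N.
Proof.
case: i => [|i].
  by rewrite /opening/= lexx wbp_index0 andbC; have [-> _ _ _] := s_ge0.
rewrite /opening wbp_indexS opens_wbpS/= sojourn_ge0//= andbC.
by case: leP => //= _; rewrite addn1.
Qed.

Lemma sum_openingE n m : (\sum_(i < m.+1) opening n i = minn (idx m).+1 n)%N.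
Proof.
elim: m => [|m IH].
  rewrite big_ord_recr big_ord0/= add0n wbp_index0 openingE wbp_index0/=.
  by case: n => // n; rewrite minnSS min0n.
rewrite big_ord_recr/= {}IH openingE wbp_indexS.
by case: opens_wbp; rewrite ?addn0 ?addn1//; case: (ltnP _ n) => /=; lia.
Qed.

Lemma recon_opening i : opens_wbp s i -> recon s i = sojourn s i.
Proof. by case: i => [//|i oi]; rewrite /recon (max_idPl _). Qed.

Lemma slow_recon i : opens_wbp s i -> slow i -> 2 < recon s i.
Proof.
have [g0 w0 b0 i0] := s_ge0.
move=> oi; rewrite recon_opening// => /orP[w2|].
  rewrite (lt_le_trans w2)// lerBrDl departure_ge//.
move=> /andP[w1] /and4P[coin i2 x2 /andP[pg gp]].
suff : arrival s i + 1 <= idle_done (clear s i) (arrival s i) (icoin s i) (isvc s i).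
  rewrite /sojourn /departure /serve => h.
  have : idle_done (clear s i) (arrival s i) (icoin s i) (isvc s i) <=
    Num.max (arrival s i)
    (idle_done (clear s i) (arrival s i) (icoin s i) (isvc s i)).
    by rewrite le_max lexx orbT.
  by lra.
case: i oi coin i2 x2 w1 pg gp => [_|i oi] coin i2 x2 w1 pg gp.
  apply: le_trans (idle_done_ge1 (i0 _) coin _).
    by move: gp i2; rewrite /arrival big_ord_recr big_ord0/= !add0r; lra.
  by rewrite /arrival big_ord_recr big_ord0/= !add0r.
move: pg gp; rewrite /= /sojourn arrivalS => pg gp.
have [b|b] := posnP (batch s i).
  have clE : clear s i.+1 = departure s i.
    by rewrite /= b big_ord0 addr0.
  by apply: le_trans (idle_done_ge1 (i0 _) coin _); rewrite -/(clear s i.+1) clE; lra.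
apply: le_trans (idle_done_ge _ _ _ (i0 _)).
rewrite -[serve _ _ _]/(departure s i) -[X in _ <= _ + X]/(batch_load s i).
suff : bsvc s i 0 <= batch_load s i by move: x2 => /=; lra.
rewrite /batch_load; case: (batch s i) b => // k _.
by rewrite big_ord_recl lerDl sumr_ge0.
Qed.

Lemma recon_undisturbed i : (forall k, icoin s i k = false) ->
  (forall k, batch s k = 0%N) -> opens_wbp s i -> recon s i = wsvc s i.
Proof.
have [g0 w0 b0 i0] := s_ge0.
move=> c0 b oi; rewrite recon_opening// /sojourn /departure /serve.
rewrite idle_done_nocoin// (max_idPl _); first by rewrite addrC addrA addNr add0r.
case: i oi {c0} => [_|i oi] /=.
  by rewrite /arrival big_ord_recr big_ord0/= add0r.
by rewrite b big_ord0 addr0.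
Qed.

(** A quick record belongs to a finished W-BP, whose first job opens it and is
    not slow; distinct W-BPs have distinct first jobs. *)
Lemma quick_count_le n : exists m,
  (quick_count n <= \sum_(i < m) quick_opening n i)%N.
Proof.
(* Induction on the number of W-BPs; m grows to include the first job of each
   quick one. *)
suff h n' : (n' <= n)%N -> exists m,
    (quick_count n' <= \sum_(i < m) (quick_opening n i && (idx i < n')))%N.
  have [m le_m] := h n (leqnn n); exists m; apply: leq_trans le_m _.
  by apply: leq_sum => i _; case: quick_opening => //=; case: (_ < _)%N.
elim: n' => [|j IH] jn.
  by exists 0%N; rewrite /quick_count !big_ord0.
have [m {}IH] := IH (ltnW jn).
have mono m' (p : pred nat) : (m <= m')%N ->
    (\sum_(i < m) p i <= \sum_(i < m') p i)%N.
  by move=> mm'; rewrite -!(big_mkord xpredT (fun i =>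
    nat_of_bool (p i))) (big_cat_nat (leq0n m) mm')/= leq_addr.
rewrite /quick_count big_ord_recr/= -/(quick_count j).
have [qj|_] := boolP (quick_record _); last first.
  exists m; rewrite addn0; apply: leq_trans IH _.
  apply: leq_sum => i _; case: quick_opening => //=.
  by case: (ltnP (idx i) j) => // ij; rewrite (leqW ij).
have [sz rj] := andP qj.
have [i [m' [oi ij jm' headE]]] := wbp_head_started sz.
exists (maxn m i.+1).
apply: (@leq_trans (\sum_(k < maxn m i.+1) ((quick_opening n k && (idx k < j)) +
  (k == i :> nat)))).
  rewrite big_split/= leq_add//.
    apply: leq_trans IH _.
    exact: (mono _ (fun k => quick_opening n k && (idx k < j)%N) (leq_maxl _ _)).
  have im : (i < maxn m i.+1)%N by rewrite leq_maxr.
  by rewrite (bigD1 (Ordinal im))//= eqxx.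
apply: leq_sum => k _; have [->|ki] := eqVneq (k : nat) i.
  rewrite ij ltnn andbF ltnSn andbT /quick_opening openingE oi ij jn/=.
  rewrite add0n; case: (boolP (slow i)) => // /(slow_recon oi).
  by move: rj; rewrite headE/=; lra.
rewrite addn0; case: quick_opening => //=.
by case: (ltnP (idx k) j) => // kj; rewrite (leqW kj).
Qed.

(** Without insertions slow only depends on the true service time, which is
    the reconstructed one for a first job. The hypothesis on m guarantees that
    the first n W-BPs are finished. *)
Lemma quick_count_ge n m : (n <= idx m)%N -> 
  (forall i k, icoin s i k = false) -> (forall k, batch s k = 0%N) -> 
  (\sum_(i < m) quick_opening n i <= quick_count n)%N.
Proof.
move=> nm c0 b.
have quickP i : quick_opening n i -> [/\ (idx i < n)%N, i = wbp_first s (idx i) &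
    quick_record (wbp_record s (idx i))].
  move=> /andP[]; rewrite openingE => /andP[oi idxi] ns.
  have idxm : (idx i < idx m)%N by rewrite (leq_trans idxi).
  split=> //; first exact: opens_wbp_first idxm.
  have [sz headE] := wbp_head_record oi idxm.
  rewrite /quick_record sz headE/= recon_undisturbed// leNgt.
  by move: ns; rewrite /slow negb_or => /andP[].
apply: (@leq_trans (\sum_(i < m) \sum_(j < n)
    (quick_record (wbp_record s j) * (i == wbp_first s j :> nat))))%N.
  apply: leq_sum => i _; have [qi|//] := boolP (quick_opening n i).
  have [idxi iE qr] := quickP _ qi.
  by rewrite (bigD1 (Ordinal idxi))//= qr -iE eqxx.
rewrite exchange_big/=; apply: leq_sum => j _.
rewrite -big_distrr/= -[leqRHS]muln1 leq_mul2l; apply/orP; right.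
have [jm|jm] := ltnP (wbp_first s j) m.
  rewrite (bigD1 (Ordinal jm))//= eqxx big1// => i /eqP ij.
  by apply/eqP; rewrite eqb0; apply/eqP => ijE; apply: ij; exact: val_inj.
rewrite big1// => i _; apply/eqP; rewrite eqb0; apply/eqP => ijE.
by move: (ltn_ord i); rewrite ijE ltnNge jm.
Qed.

Lemma sum_opening_ge n m : (n <= idx m)%N -> (n <= \sum_(i < m) opening n i)%N.
Proof.
case: m => [|m nm]; first by rewrite wbp_index0 leqn0 => /eqP ->.
rewrite sum_openingE leq_min leqnn andbT (leq_trans nm)//.
by rewrite wbp_indexS; case: opens_wbp; rewrite ?addn1 ?addn0.
Qed.

End slow_first_jobs.

(** * Measurability of the queueing quantities *)

Section measurability_lemmas.
Context d (T : measurableType d) (R : realType).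

Lemma measurable_bool (b : T -> bool) :
  measurable [set w | b w] -> measurable_fun setT b.
Proof.
move=> mb; apply: (measurable_fun_bool true).
by rewrite setTI.
Qed.

Lemma cvgn_limn_einf_esup (u : R^nat) :
  cvgn u <-> limn_einf (EFin \o u) = limn_esup (EFin \o u) /\
     limn_esup (EFin \o u) \is a fin_num.
Proof.
split=> [/cvg_ex[/= l ul]|[einfE fin]].
  have /cvg_limn_einf_sup[-> ->] : EFin \o u @ \oo --> l%:E by apply: cvg_EFin => //;
    exact: nearW.
  by [].
suff : EFin \o u @ \oo --> (fine (limn_esup (EFin \o u)))%:E.
  by move=> /fine_cvgP[_ h]; apply/cvg_ex; eexists; exact: h.
rewrite fineK//; apply: (@squeeze_cvge _ _ _ _ (einfs (EFin \o u)) _ (esups (EFin \o u))).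
- apply: nearW => n; apply/andP; split.
    by apply: ereal_inf_lbound; exists n => /=.
  by apply: ereal_sup_ubound; exists n => /=.
- by rewrite -einfE limn_einf_lim; exact: is_cvg_einfs.
- by rewrite limn_esup_lim; exact: is_cvg_esups.
Qed.

(** The limit is the upper limit on the measurable set where the upper and
    lower limits agree and are finite, and a default value elsewhere. *)
Lemma measurable_limn (h : nat -> T -> R) :
  (forall m, measurable_fun setT (h m)) ->
  measurable_fun setT (fun w => limn (h ^~ w)).
Proof.
move=> mh; pose E m w := (h m w)%:E.
have mE m : measurable_fun setT (E m) by exact/measurable_EFinP.
have msup : measurable_fun setT (fun w => limn_esup (E ^~ w)) by exact:
  measurable_fun_limn_esup.
have minf : measurable_fun setT (fun w => limn_einf (E ^~ w)).
  rewrite /limn_einf; apply: measurableT_comp => //.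
  apply: measurable_fun_limn_esup => m; exact: measurableT_comp.
pose b w := `[< cvgn (h ^~ w) >].
have mb : measurable_fun setT b.
  apply: measurable_bool.
  have -> : [set w | b w] = (setT `&` [set w | limn_einf (E ^~ w) =
    limn_esup (E ^~ w)]) `&`
      (setT `&` (fun w => limn_esup (E ^~ w)) @^-1` [set x | x \is a fin_num]).
    by rewrite !setTI; apply/seteqP; split=> w /=; rewrite /b asboolE =>
      /cvgn_limn_einf_esup.
  apply: measurableI; first exact: measurable_eqe.
  exact: (emeasurable_fin_num measurableT msup).
rewrite (_ : (fun w => _) = fun w => if b w then fine (limn_esup (E ^~ w)) else point);
  last first.
  apply/funext => w; case: ifPn => [/asboolP cw|/asboolPn ncw]; last exact: dvgP.
  have /cvg_ex[l hl] := cw.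
  have /cvg_limn_einf_sup[_ ->] : E ^~ w @ \oo --> l%:E by apply: cvg_EFin => //; exact:
    nearW.
  exact: cvg_lim.
apply: measurable_fun_ifT => //; exact: measurableT_comp.
Qed.

Lemma measurable_forall_ord k (b : nat -> T -> bool) :
  (forall j, (j < k)%N -> measurable_fun setT (b j)) ->
  measurable_fun setT (fun w => [forall j : 'I_k, b j w]).
Proof.
move=> mb; apply: measurable_bool.
have -> : [set w | [forall j : 'I_k, b j w]] = \bigcap_(j in `I_k) [set w | b j w].
  apply/seteqP; split=> w /=.
    by move=> /forallP h j /= jk; exact: (h (Ordinal jk)).
  by move=> h; apply/forallP => j; exact: (h j (ltn_ord j)).
by apply: fin_bigcap_measurable => // j /= jk; apply: measurable_pred; exact: mb.
Qed.

Lemma measurable_sum_ord k (f : nat -> T -> R) :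
  (forall j, (j < k)%N -> measurable_fun setT (f j)) ->
  measurable_fun setT (fun w => \sum_(j < k) f j w).
Proof.
move=> mf.
by apply: (@measurable_sum _ _ _ _ _ _ (fun (j : 'I_k) w => f j w)) => -[j jk]; exact: mf.
Qed.

Lemma measurable_sumn_ord k (f : nat -> T -> nat) :
  (forall j, (j < k)%N -> measurable_fun setT (f j)) ->
  measurable_fun setT (fun w => \sum_(j < k) f j w)%N.
Proof.
elim: k => [|k IH] mf.
  by under eq_fun do rewrite big_ord0; exact: measurable_cst.
under eq_fun do rewrite big_ord_recr/=.
apply: measurable_fun_addn; last exact: mf.
by apply: IH => j jk; apply: mf; rewrite ltnS ltnW.
Qed.

Lemma measurable_nat_of_bool (b : T -> bool) :
  measurable_fun setT b -> measurable_fun setT (fun w => nat_of_bool (b w)).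
Proof. by move=> mb; apply: measurableT_comp. Qed.

Lemma measurable_nat_choice (N : T -> nat) (f : nat -> T -> R) :
  measurable_fun setT N -> (forall k, measurable_fun setT (f k)) ->
  measurable_fun setT (fun w => f (N w) w).
Proof.
move=> mN mf _ Y mY; rewrite setTI.
have -> : (fun w => f (N w) w) @^-1` Y = \bigcup_k (N @^-1` [set k] `&` f k @^-1` Y).
  apply/seteqP; split=> [w /= Yw|w [k _ [/= -> //]]].
  by exists (N w).
apply: bigcupT_measurable => k; apply: measurableI.
  by rewrite -[X in measurable X]setTI; exact: mN.
by rewrite -[X in measurable X]setTI; exact: mf.
Qed.

End measurability_lemmas.

Section measurable_paths.
Context d (T : measurableType d) (R : realType) (s : T -> sample_path R).

(** The sources that determine the departure of job i. The domain of s may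
    carry any sigma-algebra; it will be the one generated by part of the
    sources. *)
Definition measurable_through i :=
  [/\ forall k, (k <= i)%N -> measurable_fun setT (fun w => gap (s w) k) /\
         measurable_fun setT (fun w => wsvc (s w) k),
      forall k, (k < i)%N -> measurable_fun setT (fun w => batch (s w) k) /\
         forall j, measurable_fun setT (fun w => bsvc (s w) k j) &
      forall k, (k <= i)%N -> forall j, measurable_fun setT (fun w => isvc (s w) k j) /\
         measurable_fun setT (fun w => icoin (s w) k j)].

Lemma measurable_throughW i k : (k <= i)%N -> measurable_through i ->
  measurable_through k.
Proof.
move=> ki [h1 h2 h3]; split=> l lk.
- exact/h1/(leq_trans lk).
- exact/h2/(leq_trans lk).
- exact/h3/(leq_trans lk).
Qed.

Lemma measurable_arrival i : (forall k, (k <= i)%N -> measurable_fun setT (fun w =>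
  gap (s w) k)) ->
  measurable_fun setT (fun w => arrival (s w) i).
Proof. by move=> mg; apply: (@measurable_sum_ord _ _ _ _ (fun j w => gap (s w) j)) => j;
  exact: mg. Qed.

Lemma measurable_idle_insert (e a : T -> R) (c : T -> nat -> bool) (z : T -> nat -> R) k :
  measurable_fun setT e -> measurable_fun setT a -> 
  (forall k, measurable_fun setT (c ^~ k)) -> (forall k, measurable_fun setT (z ^~ k)) ->
  measurable_fun setT (fun w => idle_insert (e w) (a w) (c w) (z w) k).
Proof.
move=> me ma mc mz.
apply: (@measurable_forall_ord _ _ _ (fun j w => c w j && (e w +
  \sum_(l < j) z w l < a w))) => j _.
apply: measurable_and; first exact: mc.
apply: measurable_fun_ltr => //; apply: measurable_funD => //.
exact: (@measurable_sum_ord _ _ _ _ (fun l w => z w l)).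
Qed.

Lemma measurable_idle_done (e a : T -> R) (c : T -> nat -> bool) (z : T -> nat -> R) :
  measurable_fun setT e -> measurable_fun setT a -> 
  (forall k, measurable_fun setT (c ^~ k)) -> (forall k, measurable_fun setT (z ^~ k)) ->
  measurable_fun setT (fun w => idle_done (e w) (a w) (c w) (z w)).
Proof.
move=> me ma mc mz; apply: (@measurable_limn _ _ _ (fun m w => e w +
  \sum_(0 <= k < m | idle_insert (e w) (a w) (c w) (z w) k) z w k)) => m.
apply: measurable_funD => //; under eq_fun do rewrite big_mkcond/=.
apply: measurable_sum => k; apply: measurable_fun_ifT => //.
exact: measurable_idle_insert.
Qed.

Lemma measurable_clear_departure i : measurable_through i ->
  measurable_fun setT (fun w => clear (s w) i) /\
  measurable_fun setT (fun w => departure (s w) i).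
Proof.
have dep k : measurable_through k -> measurable_fun setT (fun w => clear (s w) k) ->
    measurable_fun setT (fun w => departure (s w) k).
  move=> [h1 h2 h3] mcl; rewrite /departure /serve.
  have ma : measurable_fun setT (fun w => arrival (s w) k).
    by apply: measurable_arrival => j jk; have [] := h1 _ jk.
  apply: measurable_funD; last by have [] := h1 _ (leqnn k).
  apply: measurable_maxr => //; apply: measurable_idle_done => // j.
    by have [] := h3 _ (leqnn k) j.
  by have [] := h3 _ (leqnn k) j.
elim: i => [|i IH] mi.
  by have m0 : measurable_fun setT (fun w => clear (s w) 0) by []; split=> //; exact: dep.
have [mcl md] := IH (measurable_throughW (leqnSn i) mi).
suff mclS : measurable_fun setT (fun w => clear (s w) i.+1) by split=> //; exact: dep.
apply: measurable_funD; first exact: md.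
have [_ h2 _] := mi; have [mb mbs] := h2 i (ltnSn i).
apply: (@measurable_nat_choice _ _ _ _ (fun k w => \sum_(j < k) bsvc (s w) i j)) => // k.
exact: (@measurable_sum_ord _ _ _ _ (fun j w => bsvc (s w) i j)).
Qed.

Lemma measurable_departure i : measurable_through i ->
  measurable_fun setT (fun w => departure (s w) i).
Proof. by move=> /measurable_clear_departure[]. Qed.

Lemma measurable_wbp_index i : (forall k, (k < i)%N -> measurable_through k) ->
  (forall k, (k <= i)%N -> measurable_fun setT (fun w => gap (s w) k)) ->
  measurable_fun setT (fun w => wbp_index (s w) i).
Proof.
move=> mi mg.
apply: (@measurable_sumn_ord _ _ _ (fun k w => nat_of_bool (departure (s w) k <=
  arrival (s w) k.+1))) => k ki.
apply: measurable_nat_of_bool; apply: measurable_fun_ler;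
  first exact/measurable_departure/mi.
by apply: measurable_arrival => j jk; apply: mg; exact: leq_trans ki.
Qed.

Lemma measurable_sojourn i : measurable_through i ->
  measurable_fun setT (fun w => sojourn (s w) i).
Proof.
move=> mi; apply: measurable_funB; first exact: measurable_departure.
by apply: measurable_arrival => k ki; have [h1 _ _] := mi; have [] := h1 _ ki.
Qed.

Lemma measurable_through_index i : measurable_through i ->
  measurable_fun setT (fun w => wbp_index (s w) i).
Proof.
move=> mi; apply: measurable_wbp_index => [k ki|k ki].
  exact: measurable_throughW (ltnW ki) mi.
by have [h1 _ _] := mi; have [] := h1 _ ki.
Qed.

Lemma measurable_prev_sojourn i : (forall k, (k < i)%N -> measurable_through k) ->
  measurable_fun setT (fun w => prev_sojourn (s w) i).
Proof. by case: i => [|i] mi //=; apply: measurable_sojourn; exact: mi. Qed.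

Lemma measurable_next_wbp i : (forall k, (k < i)%N -> measurable_through k) ->
  measurable_fun setT (fun w => next_wbp (s w) i).
Proof.
case: i => [|i] mi //=; have {}mi := mi i (ltnSn i).
exact: (measurableT_comp (_ : measurable_fun setT S) (measurable_through_index mi)).
Qed.

Lemma measurable_opening n i : measurable_through i ->
  measurable_fun setT (fun w => opening (s w) n i).
Proof.
move=> mi; have mk k : (k < i)%N -> measurable_through k.
  by move=> /ltnW ki; exact: measurable_throughW mi.
have mp := measurable_prev_sojourn mk.
apply: measurable_and.
  by apply: measurable_fun_ltn => //; exact: measurable_next_wbp.
apply: measurable_and; first exact: measurable_fun_ler.
by apply: measurable_fun_ler => //; have [h1 _ _] := mi; have [] := h1 i (leqnn i).
Qed.

Lemma measurable_quick_opening n i : measurable_through i ->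
  measurable_fun setT (fun w => quick_opening (s w) n i).
Proof.
move=> mi; have mk k : (k < i)%N -> measurable_through k.
  by move=> /ltnW ki; exact: measurable_throughW mi.
have mp := measurable_prev_sojourn mk.
have [h1 h2 h3] := mi; have [mg mw] := h1 i (leqnn i).
apply: measurable_and; first exact: measurable_opening.
apply: measurable_neg; apply: measurable_or; first exact: measurable_fun_ltr.
apply: measurable_and; first exact: measurable_fun_ltr.
have [ms mc] := h3 i (leqnn i) 0%N.
apply: measurable_and => //; apply: measurable_and; first exact: measurable_fun_ltr.
apply: measurable_and.
  apply: measurable_fun_ltr => //.
  case: i {mi mk mp h1 mg mw ms mc} h2 h3 => [|i] h2 h3.
    by have [] := h3 0%N (leqnn 0) 1%N.
  by have [_ mb] := h2 i (ltnSn i); exact: mb.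
apply: measurable_and; first exact: measurable_fun_ltr.
by apply: measurable_fun_ler => //; exact: measurable_funD.
Qed.

Lemma measurable_recon i : measurable_through i ->
  measurable_fun setT (fun w => recon (s w) i).
Proof.
move=> mi; have ma k : (k <= i)%N -> measurable_fun setT (fun w => arrival (s w) k).
  move=> ki; apply: measurable_arrival => j jk.
  by have [h1 _ _] := mi; have [] := h1 _ (leq_trans jk ki).
case: i mi ma => [|i] mi ma.
  by apply: measurable_funB; [exact: measurable_departure|exact: ma].
apply: measurable_funB; first exact: measurable_departure.
apply: measurable_maxr; first exact: ma.
exact/measurable_departure/(measurable_throughW _ mi).
Qed.

End measurable_paths.

(** * A second moment bound for compensated counts *)

Section second_moment.
Context d (T : measurableType d) (R : realType) (P : probability T R).

Definition tame (f : T -> R) := measurable_fun setT f /\ exists M, forall w, `|f w| <= M.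

Lemma tame_integrable f : tame f -> P.-integrable setT (EFin \o f).
Proof.
move=> [mf [M fM]]; apply: measurable_bounded_integrable => //.
  by rewrite (le_lt_trans (probability_le1 P measurableT)) ?ltry.
by exists M; split; [exact: num_real|move=> x Mx w _ /=; rewrite (le_trans (fM w))// ltW].
Qed.

Lemma tameD f g : tame f -> tame g -> tame (fun w => f w + g w).
Proof.
move=> [mf [M fM]] [mg [N gN]]; split; first exact: measurable_funD.
by exists (M + N) => w; rewrite (le_trans (ler_normD _ _))// lerD.
Qed.

Lemma tameM f g : tame f -> tame g -> tame (fun w => f w * g w).
Proof.
move=> [mf [M fM]] [mg [N gN]]; split; first exact: measurable_funM.
by exists (M * N) => w; rewrite normrM ler_pM.
Qed.

Lemma tame_cst r : tame (fun=> r).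
Proof. by split; [exact: measurable_cst|exists `|r|]. Qed.

Lemma tame_bool (b : T -> bool) : measurable_fun setT b -> tame (fun w => (b w)%:R).
Proof.
move=> mb; split.
  rewrite (_ : (fun w => _) = fun w => if b w then 1 else 0); last by apply/funext => w;
    case: (b w).
  by apply: measurable_fun_ifT.
by exists 1 => w; case: (b w); rewrite ?normr1 ?normr0.
Qed.

Lemma tame_sum k (f : nat -> T -> R) : (forall i, tame (f i)) ->
  tame (fun w => \sum_(i < k) f i w).
Proof.
move=> tf; elim: k => [|k IH].
  by under eq_fun do rewrite big_ord0; exact: tame_cst.
by under eq_fun do rewrite big_ord_recr/=; exact: tameD.
Qed.

Definition mean (f : T -> R) : R := Rintegral P setT f.

Lemma meanD f g : tame f -> tame g -> mean (fun w => f w + g w) = mean f + mean g.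
Proof. by move=> /tame_integrable tf /tame_integrable tg; rewrite /mean RintegralD. Qed.

Lemma meanZ r f : tame f -> mean (fun w => r * f w) = r * mean f.
Proof. by move=> /tame_integrable tf; rewrite /mean RintegralZl. Qed.

Lemma mean_le f g : tame f -> tame g -> (forall w, f w <= g w) -> mean f <= mean g.
Proof.
by move=> tf tg fg; apply: le_Rintegral => //; exact: tame_integrable.
Qed.

Lemma integral_bool (b : T -> bool) : measurable_fun setT b ->
  (\int[P]_w ((b w)%:R)%:E = P [set w | b w])%E.
Proof.
move=> /measurable_pred mb.
rewrite -[in RHS](setIT [set w | b w]) -integral_indic//.
by apply: eq_integral => w _; rewrite indicE; congr ((nat_of_bool _)%:R)%:E;
  apply/idP/idP; rewrite inE.
Qed.

Lemma mean_bool (b : T -> bool) : measurable_fun setT b ->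
  mean (fun w => (b w)%:R) = fine (P [set w | b w]).
Proof. by move=> mb; rewrite /mean /Rintegral integral_bool. Qed.

Lemma mean_sum k (f : nat -> T -> R) : (forall i, tame (f i)) ->
  mean (fun w => \sum_(i < k) f i w) = \sum_(i < k) mean (f i).
Proof.
move=> tf; elim: k => [|k IH].
  by under eq_fun do rewrite big_ord0; rewrite big_ord0 /mean Rintegral_cst// mul0r.
under eq_fun do rewrite big_ord_recr/=.
by rewrite meanD ?IH ?big_ord_recr//; exact: tame_sum.
Qed.

Variables (a b : nat -> T -> bool) (r : R) (n m : nat).
Hypothesis ma : forall i, measurable_fun setT (a i).
Hypothesis mb : forall i, measurable_fun setT (b i).
Hypothesis ab : forall i w, a i w -> b i w.
Hypothesis r01 : 0 <= r <= 1.
Local Notation pr c := (fine (P [set w | c w])).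
Hypothesis aa : forall i j, (i < j)%N ->
  pr (fun w => a i w && a j w) = r * pr (fun w => a i w && b j w).
Hypothesis ba : forall i j, (i < j)%N ->
  pr (fun w => b i w && a j w) = r * pr (fun w => b i w && b j w).
Hypothesis sumb : forall w, (\sum_(i < m) b i w <= n)%N.

Let D i w : R := (a i w)%:R - r * (b i w)%:R.
Let S k w : R := \sum_(i < k) D i w.

Let tD i : tame (D i).
Proof.
rewrite /D; under eq_fun do rewrite -mulNr.
apply: tameD; first exact: tame_bool.
by apply: tameM; [exact: tame_cst|exact: tame_bool].
Qed.

Let tS k : tame (S k). Proof. exact: tame_sum. Qed.

Let DD i j : (i < j)%N -> mean (fun w => D i w * D j w) = 0.
Proof.
move=> ij.
have E w : D i w * D j w = ((a i w && a j w)%:R + - r * (a i w && b j w)%:R) +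
   (- r * (b i w && a j w)%:R + r ^+ 2 * (b i w && b j w)%:R).
  rewrite /D; case: (a i w); case: (a j w); case: (b i w); case: (b j w) => /=; ring.
have mab (x y : nat -> T -> bool) : (forall i, measurable_fun setT (x i)) ->
    (forall i, measurable_fun setT (y i)) ->
    measurable_fun setT (fun w => x i w && y j w) by move=> mx my; exact: measurable_and.
have tab (x y : nat -> T -> bool) : (forall i, measurable_fun setT (x i)) ->
    (forall i, measurable_fun setT (y i)) -> tame (fun w => (x i w && y j w)%:R).
  by move=> mx my; apply: tame_bool; exact: mab.
have tz c (f : T -> R) : tame f -> tame (fun w => c * f w).
  by move=> tf; apply: tameM => //; exact: tame_cst.
under eq_fun do rewrite E.
rewrite !meanD//; try (by [exact: tab|apply: tz; exact: tab]);
  try (by apply: tameD; [try (by exact: tab); apply: tz; exact: tab|apply: tz; exact: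
    tab]).
rewrite !meanZ//; try exact: tab.
rewrite !mean_bool//; try exact: mab.
by rewrite aa// ba//; ring.
Qed.

Let SD k j : (k <= j)%N -> mean (fun w => S k w * D j w) = 0.
Proof.
move=> kj; rewrite /S; under eq_fun do rewrite mulr_suml.
rewrite (@mean_sum _ (fun i w => D i w * D j w)); last by move=> i; exact: tameM.
by rewrite big1// => i _; rewrite DD// (leq_trans (ltn_ord i)).
Qed.

(** The hypotheses aa and ba make the products D i * D j of distinct
    increments have mean 0, so that only the squares remain, and the square of
    D i is at most the indicator of b i. *)
Lemma second_moment : mean (fun w => S m w * S m w) <= n%:R.
Proof.
have h k : mean (fun w => S k w * S k w) <= mean (fun w => \sum_(i < k) (b i w)%:R).
  rewrite (@mean_sum _ (fun i w => (b i w)%:R)); last by move=> i; exact: tame_bool.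
  elim: k => [|k IH].
    rewrite big_ord0 /S; under eq_fun do rewrite big_ord0 mul0r.
    by rewrite /mean Rintegral_cst// mul0r.
  have E w : S k.+1 w * S k.+1 w = S k w * S k w + (2 * (S k w * D k w) + D k w * D k w).
    by rewrite /S big_ord_recr/=; ring.
  under eq_fun do rewrite E.
  have t1 := tameM (tS k) (tS k); have t2 := tameM (tS k) (tD k).
  have t4 := tameM (tD k) (tD k).
  have t3 : tame (fun w => 2 * (S k w * D k w)) by apply: tameM => //; exact: tame_cst.
  rewrite meanD//; last exact: tameD.
  rewrite meanD// meanZ// SD// mulr0 add0r big_ord_recr/= lerD//.
  apply: mean_le => //; first exact: tame_bool.
  have /andP[r0 r1] := r01.
  move=> w; rewrite /D; have := @ab k w; case: (a k w); case: (b k w) => //= h.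
  - by nra.
  - by have := h isT.
  - by nra.
  - by nra.
apply: le_trans (h m) _.
rewrite -[leRHS](_ : mean (fun=> n%:R) = n%:R); last first.
  rewrite /mean Rintegral_cst//.
  by rewrite [X in _ * X](_ : _ = 1) ?mulr1//; exact: (congr1 fine (probability_setT P)).
apply: mean_le; [|exact: tame_cst|].
  by apply: (@tame_sum _ (fun i w => (b i w)%:R)) => i; exact: tame_bool.
by move=> w; rewrite -natr_sum ler_nat.
Qed.

Lemma second_moment_tail x : 0 < x ->
  (P [set w | (x <= `|\sum_(i < m) (a i w)%:R - r * \sum_(i < m) (b i w)%:R|)%R ] <=
   (n%:R / x ^+ 2)%:E)%E.
Proof.
move=> x0.
have SE w : \sum_(i < m) (a i w)%:R - r * \sum_(i < m) (b i w)%:R = S m w.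
  by rewrite mulr_sumr -sumrB.
under eq_set do rewrite SE.
pose c w := x <= `|S m w|.
have mc : measurable_fun setT c.
  apply: measurable_fun_ler => //; apply: measurableT_comp => //; exact: (tS m).1.
have mcs := measurable_pred mc.
rewrite -[P _]fineK ?fin_num_measure// lee_fin -mean_bool//.
rewrite ler_pdivlMr ?exprn_gt0// mulrC -meanZ ?exprn_gt0//; last exact: tame_bool.
apply: le_trans second_moment; apply: mean_le.
- by apply: tameM; [exact: tame_cst|exact: tame_bool].
- exact: tameM.
- move=> w; rewrite -expr2 -[leRHS]real_normK ?num_real// /c.
  case: (leP x) => xS /=; rewrite ?mulr1 ?mulr0 ?exprn_ge0//.
  by rewrite ler_sqr ?nnegrE// ltW.
Qed.

End second_moment.

(** * Sigma-algebras generated by sets of sources *)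

Section known_sources.
Context d (T : measurableType d) (R : realType) (P : probability T R).
Variable X : primitives P.

Definition known (I : set source) :=
  g_sigma_algebraType (\bigcup_(u in I) source_events X u).

Lemma source_events_measurable u : source_events X u `<=` measurable.
Proof.
by case: u => [i|i|i j|i j|i j|i|i] _ [Y mY <-]; exact: measurable_funP.
Qed.

Lemma source_eventsT u : source_events X u setT.
Proof. by case: u => *; exists setT => //; rewrite setTI. Qed.

Lemma source_eventsI u : setI_closed (source_events X u).
Proof.
by case: u => [i|i|i j|i j|i j|i|i] _ _ [Y mY <-] [Z mZ <-];
  exists (Y `&` Z); rewrite ?preimage_setI ?setTI//; exact: measurableI.
Qed.

Section one_source_set.
Variable I : set source.

Lemma known_event u E : I u -> source_events X u E -> measurable (E : set (known I)).
Proof. by move=> Iu XE; apply: sub_sigma_algebra; exists u. Qed.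

Lemma known_gap k : I (Gap k) -> measurable_fun (setT : set (known I)) (rgap X k).
Proof. by move=> Iu _ Y mY; apply: (known_event Iu); exists Y. Qed.

Lemma known_wsvc k : I (WSvc k) -> measurable_fun (setT : set (known I)) (rwsvc X k).
Proof. by move=> Iu _ Y mY; apply: (known_event Iu); exists Y. Qed.

Lemma known_bsvc k j : I (BSvc k j) -> measurable_fun (setT :
  set (known I)) (rbsvc X k j).
Proof. by move=> Iu _ Y mY; apply: (known_event Iu); exists Y. Qed.

Lemma known_isvc k j : I (ISvc k j) -> measurable_fun (setT :
  set (known I)) (risvc X k j).
Proof. by move=> Iu _ Y mY; apply: (known_event Iu); exists Y. Qed.

Lemma known_icoin k j : I (ICoin k j) -> measurable_fun (setT :
  set (known I)) (ricoin X k j).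
Proof. by move=> Iu _ Y mY; apply: (known_event Iu); exists Y. Qed.

Lemma known_batch k : I (ACoin k) -> I (BSize k) ->
  measurable_fun (setT : set (known I)) (fun w =>
    if racoin X k w then rsize X k w else 0%N).
Proof.
move=> I1 I2; apply: measurable_fun_ifT => //.
- by move=> _ Y mY; apply: (known_event I1); exists Y.
- by move=> _ Y mY; apply: (known_event I2); exists Y.
Qed.

End one_source_set.

Lemma known_mono (I I' : set source) (H : set T) : I `<=` I' ->
  measurable (H : set (known I)) -> measurable (H : set (known I')).
Proof.
move=> II'; move: H; apply: smallest_sub; first exact: smallest_sigma_algebra.
by move=> E [u /II' Iu XE]; exact: known_event XE.
Qed.

(** The sources that are used before the gap preceding job i. The batch
    inserted at the arrival of job k delays job k.+1 at the earliest. *)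
Definition past (i : nat) : set source := fun u =>
  match u with
  | Gap k | WSvc k | ISvc k _ | ICoin k _ => (k < i)%N
  | BSvc k _ | ACoin k | BSize k => (k.+1 < i)%N
  end.

Definition past_gap i : set source := past i `|` [set Gap i].

Lemma past_through (I : set source) i : past i.+1 `<=` I ->
  measurable_through (path_H1 X : known I -> sample_path R) i.
Proof.
move=> sI; split=> k ki.
- by split; [apply: known_gap|apply: known_wsvc]; apply: sI => /=; rewrite ltnS.
- split=> [|j]; first by apply: known_batch; apply: sI => /=; rewrite ltnS.
  by apply: known_bsvc; apply: sI => /=; rewrite ltnS.
- by move=> j; split; [apply: known_isvc|apply: known_icoin]; apply: sI => /=;
  rewrite ltnS.
Qed.

Lemma all_through i : measurable_through (path_H1 X) i.
Proof.
split=> k ki /=.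
- by split.
- by split=> //; apply: measurable_fun_ifT.
- by [].
Qed.

Lemma past_leq i j : (i <= j)%N -> past i `<=` past j.
Proof. by move=> ij; case=> [k|k|k l|k l|k l|k|k] /=; lia. Qed.

Lemma past_gap_through (I : set source) i : past_gap i `<=` I ->
  forall k, (k < i)%N -> measurable_through (path_H1 X : known I -> sample_path R) k.
Proof.
move=> sI k ki; apply: past_through => u /(past_leq ki) pu; apply: sI; by left.
Qed.

Lemma known_wbp_index (I : set source) i : past_gap i `<=` I ->
  measurable_fun (setT : set (known I)) (fun w => wbp_index (path_H1 X w) i).
Proof.
move=> sI; apply: measurable_wbp_index; first exact: past_gap_through.
move=> k; rewrite leq_eqVlt => /predU1P[->|ki]; apply: known_gap; apply: sI.
  by right.
by left.
Qed.

Lemma tail_event (Y : {RV P >-> R}) u r :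
  source_events X u = preimage_set_system setT Y measurable ->
  source_events X u [set w | r < Y w].
Proof.
move=> ->; exists `]r, +oo[%classic; first exact: measurable_itv.
by rewrite setTI; apply/seteqP; split=> w /=; rewrite in_itv/= andbT.
Qed.

Hypothesis X_indep : mutual_indep P (source_events X).

Lemma known_measurable I (H : set T) : measurable (H : set (known I)) -> measurable H.
Proof.
move: H; apply: smallest_sub; first exact: sigma_algebra_measurable.
by move=> E [u _]; exact: source_events_measurable.
Qed.

Lemma known_indep I u (H E : set T) : ~ I u -> measurable (H : set (known I)) ->
  source_events X u E -> P (H `&` E) = (P H * P E)%E.
Proof.
move=> nIu mH XE.
exact: (mutual_indep_sigma source_events_measurable source_eventsT
  source_eventsI X_indep nIu XE mH).
Qed.

End known_sources.

(** * Conditional probability that a first job is quick *)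

(** The factors of the product after q are the probabilities that the
    service times of the two jobs of Alice exceed 2 and that the gap exceeds
    prev_sojourn by at most 1, given that the job opens a W-BP. *)
Definition quick_rate (R : realType) (lam mu1 mu2 q : R) : R :=
  1 - (expR (- mu1 * 2) + (expR (- mu1 * 1) - expR (- mu1 * 2)) * q *
    expR (- mu2 * 2) * expR (- mu2 * 2) * (1 - expR (- lam * 1))).

Section quick_openings.
Context d (T : measurableType d) (R : realType) (P : probability T R).
Variables (lam mu1 mu2 q : R) (Q : probability nat R) (X : primitives P).
Hypothesis lam_gt0 : 0 < lam.
Hypothesis q01 : 0 <= q <= 1.
Hypothesis model : iia_model lam mu1 mu2 q Q X.
Local Notation s := (path_H1 X).
Local Notation known := (known X).

Let indep := sources_indep model.

Let spareX i : {RV P >-> R} := if i is i'.+1 then rbsvc X i' 0 else risvc X 0 1.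

Let spare_source i := if i is i'.+1 then BSvc i' 0 else ISvc 0 1.

Let spareE i w : spare_svc (s w) i = spareX i w.
Proof. by case: i. Qed.

(** Under the event H from the past, a W-BP opens when 0 <= Z <= gap, where Z
    is prev_sojourn on the relevant part of H and -1 elsewhere. The other
    sources in the definition of slow are independent of the past and of this
    gap, and contribute their probabilities as factors; the condition on the
    gap in blocked is handled by memorylessness. *)
Lemma quick_openings_ratio n j (H : set T) : measurable (H : set (known (past j))) ->
  P (H `&` [set w | quick_opening (s w) n j]) =
  ((quick_rate lam mu1 mu2 q)%:E * P (H `&` [set w | opening (s w) n j]))%E.
Proof.
move=> mH.
(* Folding H and the other conditions into the sign of Z leaves a statement
   about one variable from the past and the gap. *)
pose b w := (w \in H) && ((next_wbp (s w) j < n)%N && (0 <= prev_sojourn (s w) j)).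
pose Z w := if b w then prev_sojourn (s w) j else -1.
have mk k : (k < j)%N -> measurable_through (s : known (past j) -> sample_path R) k.
  by move=> kj; apply: past_through; exact: past_leq.
have mp : measurable_fun (setT : set (known (past j))) (fun w => prev_sojourn (s w) j).
  exact: measurable_prev_sojourn.
have mZ : measurable_fun (setT : set (known (past j))) Z.
  apply: measurable_fun_ifT => //; apply: measurable_and.
    apply: measurable_bool; rewrite (_ : [set w | w \in H] = H)//.
    by apply/seteqP; split=> w /=; rewrite inE.
  apply: measurable_and; last exact: measurable_fun_ler.
  apply: measurable_fun_ltn => //; exact: measurable_next_wbp.
have mZT : measurable_fun (setT : set T) Z.
  move=> _ Y mY; apply: (@known_measurable _ _ _ _ X (past j)).
  by rewrite -(setTI (Z @^-1` Y)) setIA setIid; exact: mZ.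
pose Zm := HB.pack_for {mfun T >-> R} Z (isMeasurableFun.Build _ _ _ _ Z mZT).
pose C0 := [set w | 0 <= Z w /\ Z w < rgap X j w <= Z w + 1].
pose D0 := [set w | 0 <= Z w <= rgap X j w].
have notpast : ~ past j (Gap j) by rewrite /= ltnn.
have memZ : P C0 = ((1 - expR (- lam * 1))%:E * P D0)%E.
  apply: (@memoryless _ _ _ _ _ Zm (rgap X j)) => //; first exact: (gap_law model).
  move=> A B mA mB; apply: (known_indep indep notpast); last by exists B => //;
    rewrite setTI.
  by rewrite -[X in measurable X]setTI; exact: mZ.
have D0E : H `&` [set w | opening (s w) n j] = D0.
  apply/seteqP; split=> w; rewrite /D0 /Z /b /opening /=.
    by move=> [Hw /and3P[-> p0 pg]]; rewrite mem_set//= p0 p0 pg.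
  by case: ifPn => [/and3P[/set_mem Hw -> ->] /andP[_ ->]//|_]; rewrite ler0N1.
pose E1 := [set w | 2 < rwsvc X j w].
pose E1' := [set w | 1 < rwsvc X j w <= 2].
pose E2 := [set w | ricoin X j 0 w].
pose E3 := [set w | 2 < risvc X j 0 w].
pose E4 := [set w | 2 < spareX j w].
have ZE w : 0 <= Z w -> b w /\ Z w = prev_sojourn (s w) j.
  by rewrite /Z; case: ifP; rewrite // ler0N1.
have openZ w : H w -> opening (s w) n j -> Z w = prev_sojourn (s w) j.
  by move=> Hw /and3P[nw p0 _]; rewrite /Z /b mem_set// nw p0.
have AE : H `&` [set w | quick_opening (s w) n j] =
    D0 `\` ((D0 `&` E1) `|` ((((C0 `&` E1') `&` E2) `&` E3) `&` E4)).
  rewrite -D0E; apply/seteqP; split=> w.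
    move=> [Hw /andP[ow nslow]]; split => // -[[_ w2]|].
      by move: nslow; rewrite /slow negb_or => /andP[/negP].
    move=> [[[[[Z0 Zg] /andP[w1 _]] c] i2] x2].
    move: nslow; rewrite /slow negb_or => /andP[_ /negP]; apply.
    by apply/andP; split=> //; apply/and4P; split=> //;
      [rewrite spareE|rewrite -(ZE w Z0).2].
  move=> [[Hw ow] nE]; split => //; apply/andP; split => //.
  apply/negP => /orP[w2|/andP[w1 blk]]; apply: nE; first by left.
  have [w2|w2] := ltP 2 (wsvc (s w) j); first by left.
  right; move: blk => /and4P[c i2]; rewrite spareE => x2 pg.
  have zE := openZ w Hw ow.
  have z0 : 0 <= Z w by rewrite zE; move: ow => /and3P[].
  split=> //; split=> //; split=> //; split; last by rewrite /E1' /= w1.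
  by split=> //; rewrite zE.
pose I1 := past_gap j.
have sub1 : past j `<=` I1 by move=> u; left.
have mZ1 : measurable_fun (setT : set (known I1)) Z.
  by move=> _ Y mY; apply: (known_mono sub1); exact: mZ.
have mg1 : measurable_fun (setT : set (known I1)) (rgap X j).
  by apply: known_gap; right.
have mC0 : measurable (C0 : set (known I1)).
  have -> : C0 = [set w | (0 <= Z w) && ((Z w < rgap X j w) && (rgap X j w <= Z w + 1))].
    by apply/seteqP; split=> w; [move=> [z0 h]; apply/andP|move=> /andP].
  apply: measurable_pred; apply: measurable_and; first exact: measurable_fun_ler.
  apply: measurable_and; first exact: measurable_fun_ltr.
  by apply: measurable_fun_ler => //; exact: measurable_funD.
have mD0 : measurable (D0 : set (known I1)).
  by apply: measurable_pred; apply: measurable_and; exact: measurable_fun_ler.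
(* The sources are revealed one at a time, each independent of the previous
   ones. *)
pose I2 := I1 `|` [set WSvc j]; pose I3 := I2 `|` [set ICoin j 0]; pose I4 :=
  I3 `|` [set ISvc j 0].
have x1 : source_events X (WSvc j) E1 by exact: tail_event.
have x1' : source_events X (WSvc j) E1'.
  exists `]1, 2]%classic; first exact: measurable_itv.
  by rewrite setTI; apply/seteqP; split=> w /=; rewrite in_itv.
have x2 : source_events X (ICoin j 0) E2.
  by exists [set true] => //; rewrite setTI; apply/seteqP; split.
have x3 : source_events X (ISvc j 0) E3 by exact: tail_event.
have x4 : source_events X (spare_source j) E4.
  by apply: tail_event; rewrite /spareX; case: (j).
have m1 : measurable (C0 `&` E1' : set (known I2)).
  apply: measurableI; first by apply: (known_mono _ mC0) => u; left.
  by apply: (known_event _ x1'); right.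
have m2 : measurable (C0 `&` E1' `&` E2 : set (known I3)).
  apply: measurableI; first by apply: (known_mono _ m1) => u; left.
  by apply: (known_event _ x2); right.
have m3 : measurable (C0 `&` E1' `&` E2 `&` E3 : set (known I4)).
  apply: measurableI; first by apply: (known_mono _ m2) => u; left.
  by apply: (known_event _ x3); right.
have n1 : ~ I1 (WSvc j) by case=> //=; rewrite ltnn.
have n2 : ~ I2 (ICoin j 0) by case=> [[/=|//]|//]; rewrite ltnn.
have n3 : ~ I3 (ISvc j 0) by case=> [[[/=|//]|//]|//]; rewrite ltnn.
have n4 k : k = j -> ~ I4 (spare_source k).
  by case: k => [|k] kj; rewrite /I4 /I3 /I2 /I1 /past_gap -kj;
    case=> [[[[/=|//]|//]|//]|//]; rewrite ltnn.
have PD : P (D0 `&` E1) = (P D0 * (expR (- mu1 * 2))%:E)%E.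
  by rewrite (known_indep indep n1 mD0 x1) (exponential_tail (wsvc_law model j)).
have PC : P ((((C0 `&` E1') `&` E2) `&` E3) `&` E4) =
    (P C0 * (expR (- mu1 * 1) - expR (- mu1 * 2))%:E * q%:E * (expR (- mu2 * 2))%:E *
     (expR (- mu2 * 2))%:E)%E.
  rewrite (known_indep indep (n4 j erefl) m3 x4) (known_indep indep n3 m2 x3).
  rewrite (known_indep indep n2 m1 x2) (known_indep indep n1 mC0 x1').
  rewrite (exponential_oc (wsvc_law model j))// ?ler1n//.
  rewrite (bernoulli_law_true q01 (icoin_law model j 0)) (exponential_tail (isvc_law
    model j 0))//.
  congr (_ * _)%E; rewrite /E4; case: (j) => [|j'].
    by rewrite (exponential_tail (isvc_law model 0 1)).
  by rewrite (exponential_tail (bsvc_law model j' 0)).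
have km (I : set source) (B : set T) : measurable (B : set (known I)) -> measurable B.
  exact: known_measurable.
have mD0T := km _ _ mD0.
have mDE : measurable (D0 `&` E1).
  by apply: measurableI => //; exact: (source_events_measurable x1).
have mCE : measurable ((((C0 `&` E1') `&` E2) `&` E3) `&` E4).
  by apply: measurableI; [exact: (km _ _ m3)|exact: (source_events_measurable x4)].
have CD : C0 `<=` D0.
  by move=> w [z0 /andP[zg _]]; rewrite /D0/= z0 ltW.
rewrite D0E AE measureD//; last 2 first.
- exact: measurableU.
- by rewrite (le_lt_trans (probability_le1 _ _)) ?ltry.
rewrite setIidr; last by move=> w [[h _]|[[[[/CD h _] _] _] _]].
rewrite measureU//; last first.
  apply/seteqP; split=> // w [[_ w2] [[[[_ /andP[_ h] _] _] _]]].
  by move: h; rewrite leNgt w2.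
have xE : P D0 = (fine (P D0))%:E by rewrite fineK// fin_num_measure.
rewrite memZ xE -!EFinM in PC; rewrite xE -EFinM in PD.
set x := fine _ in xE PC PD *.
transitivity (x%:E - ((x * expR (- mu1 * 2))%:E + ((1 - expR (- lam * 1)) * x *
    (expR (- mu1 * 1) - expR (- mu1 * 2)) * q * expR (- mu2 * 2) * expR (- mu2 *
      2))%:E))%E.
  congr (_ - (_ + _))%E; [exact: xE|exact: PD|exact: PC].
have -> : P D0 = x%:E by [].
apply: (@etrans _ _ (quick_rate lam mu1 mu2 q * x)%:E) => //.
apply: (congr1 EFin (_ : _ - (_ + _) = _)); rewrite /quick_rate; ring.
Qed.
End quick_openings.

(** * Means of exponential variables on an independent event *)

Section exponential_means.
Context d (T : measurableType d) (R : realType) (P : probability T R).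
Variables (rate : R) (X : {RV P >-> R}) (f : T -> bool).
Hypothesis rate_gt0 : 0 < rate.
Hypothesis X_law : has_law X (exponential_prob rate).
Hypothesis mf : measurable_fun setT f.
Hypothesis fX : forall r, P ([set w | f w] `&` [set w | r < X w]) =
  (P [set w | f w] * P [set w | (r < X w)%R])%E.

(** Both means below reduce to integrals of tail probabilities, in which the
    independent event factors out. *)
Let layer_cake (g : T -> R) : measurable_fun setT g -> (forall w, 0 <= g w) ->
  (\int[P]_w (g w)%:E = \int[lebesgue_measure]_(r in `[0%R,
    +oo[) P [set w | (r < g w)%R])%E.
Proof.
move=> mg g0; pose G := HB.pack_for {mfun T >-> R} g (isMeasurableFun.Build _ _ _ _ g mg).
rewrite -[LHS]/(\int[P]_w (G w)%:E)%E -expectation_def ge0_expectation_ccdf//.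
apply: eq_integral => r _; rewrite /ccdf /distribution /pushforward.
by apply: (congr1 P); apply/seteqP; split=> w /=; rewrite in_itv/= andbT.
Qed.

Let exp_integral (A : set R) : measurable A -> A `<=` `[0, +oo[%classic ->
  (\int[lebesgue_measure]_(r in A) (expR (- rate * r))%:E =
   (rate^-1)%:E * exponential_prob rate A)%E.
Proof.
move=> mA A0; rewrite /exponential_prob -ge0_integralZl//.
- apply: eq_integral => r /[!inE] /A0 /=; rewrite in_itv/= andbT => r0.
  by rewrite exponential_pdfE// -EFinM mulrA mulVf ?mul1r ?gt_eqF.
- apply/measurable_funTS/measurable_EFinP; exact: measurable_exponential_pdf.
- by move=> r _; rewrite lee_fin exponential_pdf_ge0 ?ltW.
- by rewrite lee_fin invr_ge0 ltW.
Qed.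

Let PfX r : 0 <= r -> P [set w | f w && (r < X w)] =
  (P [set w | f w] * (expR (- rate * r))%:E)%E.
Proof.
move=> r0; rewrite -(exponential_tail X_law r0) -fX; apply: (congr1 P).
by apply/seteqP; split=> w /=; [move/andP|move=> [-> ->]].
Qed.

Let mexp : measurable_fun setT (fun r : R => (expR (- rate * r))%:E).
Proof.
apply/measurable_EFinP; apply: measurableT_comp => //.
Qed.

Lemma exponential_mean_on :
  (\int[P]_w (if f w then Num.max (X w) 0 else 0)%:E = P [set w | f w] * (rate^-1)%:E)%E.
Proof.
have mX : measurable_fun setT (fun w => Num.max (X w) 0) by exact: measurable_maxr.
rewrite layer_cake; first last.
- by move=> w; case: ifP => // _; rewrite le_max lexx orbT.
- exact: measurable_fun_ifT.
transitivity (\int[lebesgue_measure]_(r in `[0%R,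
  +oo[) (P [set w | f w] * (expR (- rate * r))%:E))%E.
  apply: eq_integral => r /[!inE]/=; rewrite in_itv/= andbT => r0.
  have r0F : (r < 0) = false by rewrite ltNge r0.
  rewrite -PfX//; apply: (congr1 P); apply/seteqP; split=> w /=.
    by case: ifP => _; rewrite ?lt_max r0F ?orbF.
  by move=> /andP[-> h]; rewrite lt_max h.
rewrite ge0_integralZl//; last exact: measurable_funTS.
rewrite exp_integral//; congr (_ * _)%E.
rewrite -X_law; last exact: measurable_itv.
rewrite [X in (_ * X)%E](_ : _ = 1%E) ?mule1//.
have := exponential_tail_le X_law (lexx 0); rewrite mulr0 expR0 => <-.
by apply: (congr1 P); apply/seteqP; split=> w /=; rewrite in_itv/= andbT.
Qed.

Lemma exponential_truncated_mean_on K : 0 < K ->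
  (\int[P]_w (if f w then Num.min (Num.max (X w) 0) K else 0)%:E =
   P [set w | f w] * ((1 - expR (- rate * K)) / rate)%:E)%E.
Proof.
move=> K0.
have mX : measurable_fun setT (fun w => Num.min (Num.max (X w) 0) K).
  by apply: measurable_minr => //; exact: measurable_maxr.
rewrite layer_cake; first last.
- by move=> w; case: ifP => // _; rewrite le_min le_max lexx orbT ltW.
- exact: measurable_fun_ifT.
transitivity (\int[lebesgue_measure]_(r in `[0%R,
  K[) (P [set w | f w] * (expR (- rate * r))%:E))%E.
  rewrite integral_mkcond [RHS]integral_mkcond; apply: eq_integral => r _ /=.
  rewrite !patchE !mem_setE !in_itv/= andbT; have [r0|//] := leP 0 r.
  have r0F : (r < 0) = false by rewrite ltNge r0.
  have [rK|rK] := ltP r K; last first.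
    rewrite (_ : [set w | _] = set0) ?measure0//; apply/seteqP; split=> // w /=.
    by case: ifP => _; rewrite ?r0F// lt_min [r < K]ltNge rK andbF.
  rewrite -PfX//; apply: (congr1 P); apply/seteqP; split=> w /=.
    by case: ifP => _; rewrite ?lt_min ?lt_max r0F// rK andbT orbF.
  by move=> /andP[-> h]; rewrite lt_min lt_max h rK.
rewrite ge0_integralZl//; last exact: measurable_funTS.
rewrite exp_integral//; last first.
  by move=> r /=; rewrite !in_itv/= andbT => /andP[].
rewrite -X_law; last exact: measurable_itv.
congr (_ * _)%E; rewrite mulrC EFinM; congr (_ * _)%E.
have XE : X @^-1` `[0, K[ = [set w | 0 <= X w] `\` [set w | K <= X w].
  apply/seteqP; split=> w /=; rewrite in_itv/=.
    by move=> /andP[-> wK]; split=> //; apply/negP; rewrite -ltNge.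
  by move=> [-> /negP]; rewrite -ltNge.
have mX0 x : measurable [set w | x <= X w].
  by apply: measurable_pred; exact: measurable_fun_ler.
have h0 := exponential_tail_le X_law (lexx 0).
have hK := exponential_tail_le X_law (ltW K0).
rewrite mulr0 expR0 in h0.
transitivity (P [set w | (0 <= X w)%R] - P [set w | (K <= X w)%R])%E; last
  by rewrite h0 hK.
rewrite /distribution /pushforward XE measureD//.
  by rewrite setIidr// => w /=; apply: le_trans; exact: ltW.
by rewrite (le_lt_trans (probability_le1 _ _)) ?ltry.
Qed.

End exponential_means.

(** * Mean load brought to the server by one Willie job *)

Section drift.
Context d (T : measurableType d) (R : realType) (P : probability T R).
Variables (lam mu1 mu2 q : R) (Q : probability nat R) (X : primitives P).
Hypothesis mu1_gt0 : 0 < mu1.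
Hypothesis mu2_gt0 : 0 < mu2.
Hypothesis q01 : 0 <= q <= 1.
Hypothesis model : iia_model lam mu1 mu2 q Q X.
Local Notation s := (path_H1 X).
Local Notation known := (known X).

Let indep := sources_indep model.

Lemma ae_exponential_ge0 rate (Y : {RV P >-> R}) : has_law Y (exponential_prob rate) ->
  {ae P, forall w, 0 <= Y w}.
Proof.
move=> Y_law; exists [set w | Y w < 0]; split.
- by apply: measurable_pred; exact: measurable_fun_ltr.
- exact: exponential_neg Y_law.
- by move=> w /= /negP; rewrite -ltNge.
Qed.

Lemma ae_nonneg_path : {ae P, forall w, nonneg_path (s w)}.
Proof.
have h1 := ae_foralln (fun i => ae_exponential_ge0 (gap_law model i)).
have h2 := ae_foralln (fun i => ae_exponential_ge0 (wsvc_law model i)).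
have h3 := ae_foralln (fun i => ae_foralln (fun j =>
  ae_exponential_ge0 (bsvc_law model i j))).
have h4 := ae_foralln (fun i => ae_foralln (fun j =>
  ae_exponential_ge0 (isvc_law model i j))).
by apply: (filterS2 _ _ (filterI h1 h2) (filterI h3 h4)) => w [? ?] [? ?]; split.
Qed.

Variable bmax : nat.
Hypothesis Q_bmax : forall k, (bmax < k)%N -> Q [set k] = 0%E.

Lemma ae_size_bound : {ae P, forall w, forall i, (rsize X i w <= bmax)%N}.
Proof.
suff h i k : {ae P, forall w, rsize X i w = k -> (k <= bmax)%N}.
  have := ae_foralln (fun i => ae_foralln (h i)).
  by apply: filterS => w hw i; exact: (hw i _ erefl).
have [kb|bk] := leqP k bmax; first by apply: aeW.
exists (rsize X i @^-1` [set k]); split.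
- exact: measurable_funPTI.
- by have /= := size_law model i (A := [set k]); rewrite Q_bmax//; apply.
- by move=> w /= /not_implyP[].
Qed.

Let icoin_prob i k : P [set w | ricoin X i k w] = q%:E.
Proof. exact: bernoulli_law_true (icoin_law model i k). Qed.

Lemma acoin_prob i : P [set w | racoin X i w] = q%:E.
Proof. exact: bernoulli_law_true (acoin_law model i). Qed.

Section load.
Variables (I : set source) (f : T -> bool).
Hypothesis kf : measurable_fun (setT : set (known I)) f.

Let mf : measurable_fun setT f.
Proof. by move=> _ Y mY; apply: (@known_measurable _ _ _ _ X I); exact: kf. Qed.

Let kF : measurable ([set w | f w] : set (known I)).
Proof. exact: measurable_pred. Qed.

Lemma known_exponential_mean rate (Y : {RV P >-> R}) u : 0 < rate ->
  has_law Y (exponential_prob rate) -> ~ I u ->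
  source_events X u = preimage_set_system setT Y measurable ->
  (\int[P]_w (if f w then Num.max (Y w) 0 else 0)%:E = P [set w | f w] * (rate^-1)%:E)%E.
Proof.
move=> r0 Y_law nIu uE; apply: exponential_mean_on => // r.
by apply: (known_indep indep nIu) => //; exact: tail_event.
Qed.

(** The coins are independent of f and of each other; the induction adds them
    one by one to the known sources. *)
Lemma known_coins_prob i k : (forall l, ~ I (ICoin i l)) ->
  let Ik := I `|` [set u | exists2 l, (l <= k)%N & u = ICoin i l] in
  measurable_fun (setT : set (known Ik)) (fun w => f w && coins_up (icoin (s w) i) k) /\
  P [set w | f w && coins_up (icoin (s w) i) k] = (P [set w | f w] * (q ^+ k.+1)%:E)%E.
Proof.
move=> nI Ik.
have kfk : measurable_fun (setT : set (known Ik)) f.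
  by move=> _ Y mY; apply: (@known_mono _ _ _ _ X I); [move=> u; left|exact: kf].
have kc k' l : (l <= k')%N -> measurable_fun (setT : set (known
    (I `|` [set u | exists2 l, (l <= k')%N & u = ICoin i l]))) (ricoin X i l).
  by move=> lk; apply: known_icoin; right; exists l.
split.
  apply: measurable_and => //; apply:
    (@measurable_forall_ord _ (known Ik) k.+1 (fun j w => ricoin X i j w)).
  by move=> j; rewrite ltnS => jk; exact: kc.
elim: k @Ik kfk => [|k IH] Ik kfk.
  have -> : [set w | f w && coins_up (icoin (s w) i) 0] =
      [set w | f w] `&` [set w | ricoin X i 0 w].
    apply/seteqP; split=> w /=.
      by move=> /andP[-> /forallP/(_ ord0)].
    by move=> [-> c]; apply/forallP => -[[|//] ?].
  rewrite (known_indep indep (nI 0%N) kF); last by exists [set true] => //;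
    rewrite setTI; apply/seteqP; split.
  by rewrite icoin_prob expr1.
have -> : [set w | f w && coins_up (icoin (s w) i) k.+1] =
    [set w | f w && coins_up (icoin (s w) i) k] `&` [set w | ricoin X i k.+1 w].
  apply/seteqP; split=> w /=; rewrite coins_upS andbA.
    by move=> /andP[].
  by move=> [-> ->].
rewrite (@known_indep _ _ _ _ X indep (I `|` [set u | exists2 l, (l <= k)%N & u =
  ICoin i l]) (ICoin i k.+1)).
- rewrite IH.
    rewrite [X in (_ * X)%E](_ : _ = q%:E); last exact: icoin_prob.
    by rewrite -muleA -EFinM -exprSr.
  by move=> _ Y mY; apply: (@known_mono _ _ _ _ X I); [move=> u; left|exact: kf].
- case=> [/nI//|[l lk [kl]]]; by move: lk; rewrite -kl ltnn.
- apply: measurable_pred; apply: measurable_and.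
    by move=> _ Y mY; apply: (@known_mono _ _ _ _ X I); [move=> u; left|exact: kf].
  apply: (@measurable_forall_ord _ (known _) k.+1 (fun j w => ricoin X i j w)).
  by move=> j; rewrite ltnS => jk; exact: kc.
- by exists [set true] => //; rewrite setTI; apply/seteqP; split.
Qed.

Lemma idle_series_le : q <= 2^-1 -> (\sum_(k <oo) (q ^+ k.+1)%:E <= (2 * q)%:E)%E.
Proof.
have /andP[q0 q1] := q01.
move=> qh; apply: lime_le.
  by apply: is_cvg_nneseries => k _ _; rewrite lee_fin exprn_ge0.
apply: nearW => N; rewrite sumEFin lee_fin.
suff : \sum_(0 <= k < N) q ^+ k.+1 <= 2 * q * (1 - q ^+ N).
  move=> /le_trans; apply; rewrite ler_piMr//; first by rewrite mulr_ge0.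
  by rewrite gerBl exprn_ge0.
elim: N => [|N IH]; first by rewrite big_nil expr0 subrr mulr0.
rewrite big_nat_recr//= (le_trans (lerD IH (lexx _)))//.
have := exprn_ge0 N.+1 q0; have := exprn_ge0 N q0; rewrite !exprS; nra.
Qed.

End load.

Section load_mean.
Variables (I : set source) (f : T -> bool).
Hypothesis kf : measurable_fun (setT : set (known I)) f.
Hypothesis q_half : q <= 2^-1.

Let mono I' g : measurable_fun (setT : set (known I)) g ->
  measurable_fun (setT : set (known (I `|` I'))) (g : T -> bool).
Proof.
by move=> kg _ Y mY; apply: (@known_mono _ _ _ _ X I); [move=> u; left|exact: kg].
Qed.

Let mknown J (g : T -> bool) : measurable_fun (setT : set (known J)) g ->
  measurable_fun setT g.
Proof. by move=> kg _ Y mY; apply: (@known_measurable _ _ _ _ X J); exact: kg. Qed.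

Let pos (Y : {RV P >-> R}) (g : T -> bool) w : \bar R :=
  (if g w then Num.max (Y w) 0 else 0)%:E.

Let pos_ge0 Y g w : (0 <= pos Y g w)%E.
Proof. by rewrite /pos lee_fin; case: ifP => // _; rewrite le_max lexx orbT. Qed.

Let mpos Y g : measurable_fun setT g -> measurable_fun setT (pos Y g).
Proof.
move=> mg; apply/measurable_EFinP; apply: measurable_fun_ifT => //.
exact: measurable_maxr.
Qed.

Definition idle_term i w : \bar R :=
  (\sum_(k <oo) (if f w && coins_up (icoin (s w) i) k then Num.max (risvc X i k w) 0
    else 0)%:E)%E.

Definition batch_term i w : \bar R :=
  (\sum_(j < bmax) (if f w && racoin X i w then Num.max (rbsvc X i j w) 0 else 0)%:E)%E.

(** The service time of job k and Alice's work that may delay it, on the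
    event f: the work inserted at idle instants before job k and the batch
    inserted after job k.-1. Positive parts only matter on a null set and make
    the terms nonnegative everywhere. *)
Definition load_term k w : \bar R :=
  ((if f w then Num.max (rwsvc X k w) 0 else 0)%:E + idle_term k w +
   (if k is k'.+1 then batch_term k' w else 0))%E.

Definition load_rate := mu1^-1 + q * (bmax.+2)%:R / mu2.

Let mcoins i k : measurable_fun setT (fun w => f w && coins_up (icoin (s w) i) k).
Proof.
apply: measurable_and; first exact: mknown kf.
exact: (@measurable_forall_ord _ _ k.+1 (fun j w => ricoin X i j w)).
Qed.

Lemma measurable_load k : measurable_fun setT (load_term k).
Proof.
apply: emeasurable_funD; first apply: emeasurable_funD.
- apply: (@mpos (rwsvc X k) f); exact: mknown kf.
- apply: ge0_emeasurable_sum => [l w _ _|l _].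
    exact: (@pos_ge0 (risvc X k l) (fun w => f w && coins_up (icoin (s w) k) l)).
  exact: (@mpos (risvc X k l) (fun w => f w && coins_up (icoin (s w) k) l)).
- case: k => [|k]; first exact: measurable_cst.
  apply: emeasurable_sum => j; apply: (@mpos (rbsvc X k j) (fun w => f w &&
    racoin X k w)).
  by apply: measurable_and => //; exact: mknown kf.
Qed.

Lemma load_ge0 k w : (0 <= load_term k w)%E.
Proof.
apply: adde_ge0; first apply: adde_ge0.
- exact: (@pos_ge0 (rwsvc X k) f).
- apply: nneseries_ge0 => l _ _.
  exact: (@pos_ge0 (risvc X k l) (fun w => f w && coins_up (icoin (s w) k) l)).
- case: k => // k; apply: sume_ge0 => j _.
  exact: (@pos_ge0 (rbsvc X k j) (fun w => f w && racoin X k w)).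
Qed.

Lemma idle_mean i : (forall l, ~ I (ICoin i l)) -> (forall l, ~ I (ISvc i l)) ->
  (\int[P]_w idle_term i w <= P [set w | f w] * (2 * q / mu2)%:E)%E.
Proof.
move=> nc ns; rewrite integral_nneseries//; last 2 first.
- by move=> k; apply: (@mpos (risvc X i k) (fun w => f w && coins_up (icoin (s w) i) k)).
- by move=> k w _; exact: (@pos_ge0 (risvc X i k) (fun w => f w &&
  coins_up (icoin (s w) i) k)).
have PfE : P [set w | f w] = (fine (P [set w | f w]))%:E.
  rewrite fineK// fin_num_measure//; apply: measurable_pred; exact: mknown kf.
set x := fine _ in PfE.
have x0 : 0 <= x by rewrite fine_ge0// measure_ge0.
have E k : (\int[P]_w (if f w &&
  coins_up (icoin (s w) i) k then Num.max (risvc X i k w) 0 else 0)%:E =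
    (x / mu2)%:E * (q ^+ k.+1)%:E)%E.
  have [kc Pc] := known_coins_prob kf k nc.
  rewrite (known_exponential_mean kc mu2_gt0 (isvc_law model i k) _ (u := ISvc i k))//.
    by rewrite Pc PfE -!EFinM mulrAC.
  by case=> [/ns//|[]].
under eq_eseriesr do rewrite E.
have /andP[q0 q1] := q01.
rewrite nneseriesZl//; last by move=> k _; rewrite lee_fin exprn_ge0.
rewrite PfE -EFinM (_ : x * (2 * q / mu2) = x / mu2 * (2 * q)); last by ring.
rewrite [X in (_ <= X)%E]EFinM lee_wpmul2l//; first by rewrite lee_fin divr_ge0// ltW.
exact: idle_series_le.
Qed.

Lemma batch_mean i : ~ I (ACoin i) -> (forall j, ~ I (BSvc i j)) ->
  (\int[P]_w batch_term i w = P [set w | f w] * (q * bmax%:R / mu2)%:E)%E.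
Proof.
move=> na nb; rewrite ge0_integral_sum//; last 2 first.
- move=> j; apply: (@mpos (rbsvc X i j) (fun w => f w && racoin X i w)).
  by apply: measurable_and => //; exact: mknown kf.
- by move=> j w _; exact: (@pos_ge0 (rbsvc X i j) (fun w => f w && racoin X i w)).
have kfa : measurable_fun (setT : set (known (I `|` [set ACoin i]))) (fun w => f w &&
  racoin X i w).
  apply: measurable_and; first exact: mono.
  by move=> _ Y mY; apply: (@known_event _ _ _ _ X _ (ACoin i)); [right|exists Y].
have Pfa : P [set w | f w && racoin X i w] = (P [set w | f w] * q%:E)%E.
  have e1 : source_events X (ACoin i) [set w | racoin X i w].
    by exists [set true] => //; rewrite setTI; apply/seteqP; split.
  rewrite -(acoin_prob i) -(known_indep indep na (measurable_pred kf) e1).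
  by apply: (congr1 P); apply/seteqP; split=> w /=; [move/andP|move=> [-> ->]].
transitivity (\sum_(j < bmax) (P [set w | f w] * (q / mu2)%:E))%E.
  apply: eq_bigr => j _.
  rewrite (known_exponential_mean kfa mu2_gt0 (bsvc_law model i j) _ (u := BSvc i j))//.
    by rewrite Pfa -muleA EFinM.
  by case=> [/nb|].
have -> : P [set w | f w] = (fine (P [set w | f w]))%:E.
  rewrite fineK// fin_num_measure//; apply: measurable_pred; exact: mknown kf.
rewrite -EFinM sumEFin -EFinM; congr _%:E.
by rewrite sumr_const card_ord -mulr_natr; ring.
Qed.

Lemma load_mean k : ~ I (WSvc k) -> (forall l, ~ I (ICoin k l)) -> (forall l,
  ~ I (ISvc k l)) ->
  (forall k', k = k'.+1 -> ~ I (ACoin k') /\ forall j, ~ I (BSvc k' j)) ->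
  (\int[P]_w load_term k w <= P [set w | f w] * load_rate%:E)%E.
Proof.
move=> nw nc ns nb; have /andP[q0 q1] := q01.
have mw : measurable_fun setT (pos (rwsvc X k) f) by apply: mpos; exact: mknown kf.
have mi : measurable_fun setT (idle_term k).
  apply: ge0_emeasurable_sum => [l w _ _|l _].
    exact: (@pos_ge0 (risvc X k l) (fun w => f w && coins_up (icoin (s w) k) l)).
  exact: (@mpos (risvc X k l) (fun w => f w && coins_up (icoin (s w) k) l)).
have i0 w : (0 <= idle_term k w)%E.
  apply: nneseries_ge0 => l _ _.
  exact: (@pos_ge0 (risvc X k l) (fun w => f w && coins_up (icoin (s w) k) l)).
have mb : measurable_fun setT (fun w => if k is k'.+1 then batch_term k' w else 0%E).
  case: (k) => [|k']; first exact: measurable_cst.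
  apply: emeasurable_sum => j; apply: (@mpos (rbsvc X k' j) (fun w => f w &&
    racoin X k' w)).
  by apply: measurable_and => //; exact: mknown kf.
have b0 w : (0 <= if k is k'.+1 then batch_term k' w else 0%E)%E.
  case: (k) => // k'; apply: sume_ge0 => j _.
  exact: (@pos_ge0 (rbsvc X k' j) (fun w => f w && racoin X k' w)).
rewrite /load_term ge0_integralD//; last 2 first.
- by move=> w _; apply: adde_ge0 => //; exact: (@pos_ge0 (rwsvc X k) f).
- exact: emeasurable_funD.
rewrite ge0_integralD//; last by move=> w _; exact: (@pos_ge0 (rwsvc X k) f).
rewrite (known_exponential_mean kf mu1_gt0 (wsvc_law model k) nw)//.
apply: (@le_trans _ _ (P [set w | f w] * (mu1^-1)%:E +
  P [set w | f w] * (2 * q / mu2)%:E +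
    P [set w | f w] * (q * bmax%:R / mu2)%:E)%E).
  apply: leeD; first by apply: leeD => //; exact: idle_mean.
  case: k {mw mi i0 mb b0 nw nc ns} nb => [|k'] nb.
    rewrite integral0 mule_ge0// lee_fin divr_ge0 ?mulr_ge0// ltW//.
  have [na nb'] := nb k' erefl.
  by rewrite batch_mean.
have -> : P [set w | f w] = (fine (P [set w | f w]))%:E.
  rewrite fineK// fin_num_measure//; apply: measurable_pred; exact: mknown kf.
rewrite -!EFinM -!EFinD lee_fin /load_rate -addn2 natrD le_eqVlt; apply/orP; left.
by apply/eqP; ring.
Qed.

End load_mean.

End drift.

(** * Number of jobs in the first n W-BPs *)

Section drift_mean.
Context d (T : measurableType d) (R : realType) (P : probability T R).
Variables (lam mu1 mu2 q : R) (Q : probability nat R) (X : primitives P).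
Hypothesis lam_gt0 : 0 < lam.
Hypothesis mu1_gt0 : 0 < mu1.
Hypothesis mu2_gt0 : 0 < mu2.
Hypothesis q01 : 0 <= q <= 1.
Hypothesis q_half : q <= 2^-1.
Hypothesis model : iia_model lam mu1 mu2 q Q X.
Variable bmax : nat.
Hypothesis Q_bmax : forall k, (bmax < k)%N -> Q [set k] = 0%E.
Local Notation s := (path_H1 X).
Local Notation known := (known X).
Local Notation c := (load_rate mu1 mu2 q bmax).

Definition serving n i w : bool := (wbp_index (s w) i < n)%N.

Lemma known_serving n i : measurable_fun (setT : set (known (past_gap i))) (serving n i).
Proof.
by apply: measurable_fun_ltn; [exact: known_wbp_index|exact: measurable_cst].
Qed.

Lemma measurable_serving n i : measurable_fun setT (serving n i).
Proof.
move=> _ Y mY; apply: (@known_measurable _ _ _ _ X (past_gap i)); exact: known_serving.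
Qed.

Lemma load_path (f : T -> bool) k w : nonneg_path (s w) -> (forall i, (rsize X i w <=
  bmax)%N) -> f w ->
  ((wsvc (s w) k)%:E + idle_load_at (s w) k +
    (if k is k'.+1 then batch_load (s w) k' else 0)%:E
    <= load_term X bmax f k w)%E.
Proof.
move=> [g0 w0 b0 i0] sz fw; rewrite /load_term fw; apply: leeD.
  apply: leeD; first by rewrite lee_fin le_max lexx.
  apply: lee_nneseries => [l _ _|l _]; first by rewrite lee_fin; case: ifP => // _;
    exact: i0.
  by rewrite fw/= lee_fin; case: ifP => // _; rewrite le_max lexx.
case: k => // k; rewrite /batch_term fw/= sumEFin lee_fin /batch_load /=.
have [ac|_] := boolP (racoin X k w); last by rewrite big_ord0 sumr_ge0.
apply: (@le_trans _ _ (\sum_(j < rsize X k w) Num.max (rbsvc X k j w) 0)).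
  by apply: ler_sum => j _; rewrite le_max lexx.
rewrite -!(big_mkord xpredT (fun j => Num.max (rbsvc X k j w) 0)).
by rewrite (big_cat_nat (leq0n _) (sz k))/= lerDl sumr_ge0// => j _;
  rewrite le_max lexx orbT.
Qed.

(** The expectation of drift_path: whether job i belongs to the first n W-BPs
    is independent of the gap after job i and of the load brought by job
    i.+1. *)
Lemma drift_mean K n m : 0 < K ->
  (\sum_(i < m) fine (P [set w | serving n i w])) * ((1 - expR (- lam * K)) / lam - c) <=
  c + K * n%:R.
Proof.
move=> K0.
have /andP[q0 q1] := q01.
have c0 : 0 <= c by rewrite addr_ge0 ?invr_ge0 ?divr_ge0 ?mulr_ge0// ltW.
set l := (1 - _) / lam.
pose p i := fine (P [set w | serving n i w]).
have pE i : P [set w | serving n i w] = (p i)%:E.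
  by rewrite fineK// fin_num_measure//; apply: measurable_pred; exact: measurable_serving.
pose L w := (\sum_(i < m) (if serving n i w then Num.min (Num.max (rgap X i.+1 w) 0) K
  else 0)%:E)%E.
pose V w := (\sum_(i < m) load_term X bmax (serving n i) i.+1 w)%E.
pose U w := (load_term X bmax (fun=> true) 0 w + (K * n%:R)%:E + V w)%E.
have mterm i : measurable_fun setT (fun w =>
  (if serving n i w then Num.min (Num.max (rgap X i.+1 w) 0) K else 0)%:E).
  apply/measurable_EFinP; apply: measurable_fun_ifT => //; first exact:
    measurable_serving.
  by apply: measurable_minr => //; exact: measurable_maxr.
have term0 i w : (0 <= (if serving n i w then Num.min (Num.max (rgap X i.+1 w) 0) K
  else 0)%:E)%E.
  by rewrite lee_fin; case: ifP => // _; rewrite le_min le_max lexx orbT ltW.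
have ktrue I : measurable_fun (setT : set (known I)) (fun=> true) by exact:
  measurable_cst.
have mload i := measurable_load bmax (@known_serving n i) i.+1.
have mload0 := measurable_load bmax (ktrue set0) 0.
have mV : measurable_fun setT V by apply: emeasurable_sum => i; exact: mload.
have V0 w : (0 <= V w)%E by apply: sume_ge0 => i _; exact: load_ge0.
have LU : {ae P, forall w, setT w -> (L w <= U w)%E}.
  apply: (filterS2 _ _ (ae_nonneg_path model) (ae_size_bound model Q_bmax)) => w w0 sz _.
  have := drift_path w0 n m (ltW K0); rewrite /L /U.
  have -> : (\sum_(i < m) (if (wbp_index (s w) i < n)%N then Num.min (gap (s w) i.+1) K
    else 0)%:E =
     \sum_(i < m) (if serving n i w then Num.min (Num.max (rgap X i.+1 w) 0) K else
       0)%:E)%E.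
    apply: eq_bigr => i _; rewrite /serving; case: ifP => // _.
    by rewrite (max_idPl _)//; have [g0 _ _ _] := w0; exact: (g0 i.+1).
  move=> /le_trans; apply; apply: leeD.
    by rewrite leeD2r//; have := @load_path (fun=> true) 0 w w0 sz isT; rewrite adde0.
  apply: lee_sum => i _; case: ifPn => [iw|_]; last exact: load_ge0.
  have := @load_path (serving n i) i.+1 w w0 sz iw.
  by rewrite EFinD addeAC.
have intL : (\int[P]_w L w = (\sum_(i < m) p i * l)%:E)%E.
  rewrite ge0_integral_sum// -sumEFin; apply: eq_bigr => i _.
  rewrite (exponential_truncated_mean_on lam_gt0 (gap_law model i.+1))//.
  - by rewrite pE.
  - exact: measurable_serving.
  - move=> r; apply: (@known_indep _ _ _ _ X (sources_indep model) (past_gap i) (Gap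
    i.+1)).
    + by case=> /= [|[/eqP]]; [rewrite ltnNge leqnSn|rewrite -{2}[i :
      nat]addn0 -addn1 eqn_add2l].
    + by apply: measurable_pred; exact: known_serving.
    + exact: tail_event.
have intU : (\int[P]_w U w <= (c + K * n%:R + \sum_(i < m) p i * c)%:E)%E.
  rewrite ge0_integralD//; last 2 first.
  - by move=> w _; rewrite adde_ge0 ?load_ge0// lee_fin mulr_ge0// ltW.
  - by apply: emeasurable_funD.
  rewrite ge0_integralD//; last 2 first.
  - by move=> w _; exact: load_ge0.
  - by move=> w _; rewrite lee_fin mulr_ge0// ltW.
  have -> : (\int[P]_w (K * n%:R)%:E = (K * n%:R)%:E)%E.
    rewrite integral_cst// -[RHS]mule1; congr (_ * _)%E; exact: probability_setT.
  rewrite !EFinD; apply: leeD; first rewrite leeD2r//.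
    have := load_mean mu1_gt0 mu2_gt0 q01 model bmax (ktrue set0) q_half (k := 0).
    rewrite [X in (_ <= X * _)%E](_ : _ = 1%E) ?mul1e; last first.
      by rewrite -[RHS](probability_setT P); apply: (congr1 P); apply/seteqP; split.
    by apply=> [[]|? []|? []|].
  rewrite ge0_integral_sum//; last by move=> i w _; exact: load_ge0.
  rewrite -sumEFin; apply: lee_sum => i _; rewrite EFinM -pE.
  apply: (load_mean mu1_gt0 mu2_gt0 q01 model bmax (@known_serving n i) q_half).
  - by case=> //=; rewrite ltnNge leqnSn.
  - by move=> j; case=> //=; rewrite ltnNge leqnSn.
  - by move=> j; case=> //=; rewrite ltnNge leqnSn.
  - move=> k' [<-]; split=> [|j]; case=> //=; rewrite ltnNge ?leqnSn//.
have : (\int[P]_w L w <= \int[P]_w U w)%E.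
  apply: ae_ge0_le_integral => //.
  - by move=> w _; apply: sume_ge0.
  - exact: emeasurable_sum.
  - move=> w _; apply: adde_ge0 => //; apply: adde_ge0; first exact: load_ge0.
    by rewrite lee_fin mulr_ge0// ltW.
  - by apply: emeasurable_funD => //; apply: emeasurable_funD.
move=> /le_trans/(_ intU); rewrite intL lee_fin.
by rewrite mulrBr !mulr_suml lerBlDr.
Qed.

End drift_mean.

(** * Mean number of insertions *)

Lemma expR_small (R : realType) (lam e : R) : 0 < lam -> 0 < e ->
  exists2 K, 0 < K & expR (- lam * K) <= e.
Proof.
move=> l0 e0; exists (lam * e)^-1; first by rewrite invr_gt0 mulr_gt0.
rewrite mulNr expRN invf_ple ?posrE ?expR_gt0//.
rewrite invfM mulrA mulfV ?gt_eqF// mul1r.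
by apply: le_trans (expR_ge1Dx _); rewrite lerDr.
Qed.

(** Since the load of Willie alone is subcritical, the truncation level K of
    the gaps and the range of q can be chosen such that drift_mean has a
    positive factor on the left. *)
Lemma serving_bound (R : realType) (lam mu1 mu2 : R) (bmax : nat) :
  0 < lam -> 0 < mu1 -> 0 < mu2 -> lam / mu1 < 1 ->
  exists q0 C : R, [/\ 0 < q0, q0 <= 2^-1, 0 < C &
    forall d (T : measurableType d) (P : probability T R) (q : R)
      (Q : probability nat R) (X : primitives P) n m,
    0 <= q <= q0 -> iia_model lam mu1 mu2 q Q X ->
    (forall k, (bmax < k)%N -> Q [set k] = 0%E) -> (0 < n)%N ->
    \sum_(i < m) fine (P [set w | serving X n i w]) <= C * n%:R].
Proof.
move=> l0 m10 m20 rho.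
have gap_pos : mu1^-1 < lam^-1.
  by rewrite ltf_pV2 ?posrE//; move: rho; rewrite ltr_pdivrMr ?mul1r.
(* The drift 1 / lam - 1 / mu1 = 2 del of Willie's own queue is spent in three
   parts: del for the truncation of the gaps, del / 2 for Alice's load, and
   del / 2 remains. *)
pose del := (lam^-1 - mu1^-1) / 2.
have del0 : 0 < del by rewrite divr_gt0 ?subr_gt0.
have [K K0 eK] := expR_small l0 (mulr_gt0 l0 del0).
pose b2 : R := bmax.+2%:R.
have b20 : 0 < b2 by rewrite ltr0n.
pose q0 := Num.min 2^-1 (del * mu2 / (2 * b2)).
exists q0, ((mu1^-1 + del / 2 + K) * (2 / del)).
have i10 : 0 < mu1^-1 by rewrite invr_gt0.
split.
- by rewrite lt_min invr_gt0 ltr0n/= divr_gt0// mulr_gt0.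
- by rewrite ge_min lexx.
- by apply: mulr_gt0; [rewrite !addr_gt0// divr_gt0|rewrite divr_gt0].
move=> d T P q Q X n m /andP[qge qle] model Qb n0.
have qh : q <= 2^-1 by rewrite (le_trans qle)// ge_min lexx.
have qd : q <= del * mu2 / (2 * b2) by rewrite (le_trans qle)// ge_min lexx orbT.
have q01 : 0 <= q <= 1 by rewrite qge (le_trans qh)// invf_le1 ?ler1n.
have := drift_mean l0 m10 m20 q01 qh model Qb n m K0.
set c := load_rate _ _ _ _; set S := \sum_(i < m) _; set l := (1 - _) / lam.
have cle : c <= mu1^-1 + del / 2.
  rewrite lerD2l ler_pdivrMr// -/b2.
  by move: qd; rewrite ler_pdivlMr ?mulr_gt0// => h; nra.
have lge : lam^-1 - del <= l.
  rewrite ler_pdivlMr// mulrBl mulVf ?gt_eqF//.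
  by rewrite lerD2l lerN2 [leRHS]mulrC.
have S0 : 0 <= S by apply: sumr_ge0 => i _; rewrite fine_ge0 ?measure_ge0.
move=> h; have lc : del / 2 <= l - c.
  have : del = lam^-1 - mu1^-1 - del by rewrite /del; lra.
  by lra.
have h2 : S * (del / 2) <= (mu1^-1 + del / 2 + K) * n%:R.
  apply: (@le_trans _ _ (S * (l - c))); first by rewrite ler_wpM2l.
  apply: le_trans h _.
  have n1 : 1 <= n%:R :> R by rewrite ler1n.
  by nra.
rewrite -ler_pdivlMr in h2; last by rewrite divr_gt0.
by apply: le_trans h2 _; rewrite invf_div [leRHS]mulrAC.
Qed.

Section mean_inserted.
Context d (T : measurableType d) (R : realType) (P : probability T R).
Variables (lam mu1 mu2 q : R) (Q : probability nat R) (X : primitives P).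
Hypothesis q01 : 0 <= q <= 1.
Hypothesis q_half : q <= 2^-1.
Hypothesis model : iia_model lam mu1 mu2 q Q X.
Variable bmax : nat.
Hypothesis Q_bmax : forall k, (bmax < k)%N -> Q [set k] = 0%E.
Local Notation s := (path_H1 X).

Let indep := sources_indep model.

Let serving_fin n i : P [set w | serving X n i w] =
  (fine (P [set w | serving X n i w]))%:E.
Proof.
rewrite fineK// fin_num_measure//; apply: measurable_pred; exact: measurable_serving.
Qed.

Let coins_mean n i k : (\int[P]_w ((serving X n i w &&
  coins_up (icoin (s w) i) k)%:R)%:E =
  (fine (P [set w | serving X n i w]) * q ^+ k.+1)%:E)%E.
Proof.
have nc l : ~ past_gap i (ICoin i l) by case=> //=; rewrite ltnn.
have [kc Pc] := known_coins_prob q01 model (@known_serving _ _ _ _ X n i) k nc.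
rewrite integral_bool; first by rewrite Pc serving_fin.
by move=> _ Y mY; exact: (known_measurable (kc measurableT Y mY)).
Qed.

Let acoin_mean n i : P [set w | serving X n i w && racoin X i w] =
  (fine (P [set w | serving X n i w]) * q)%:E.
Proof.
have na : ~ past_gap i (ACoin i) by case=> //=; rewrite ltnNge leqnSn.
have e1 : source_events X (ACoin i) [set w | racoin X i w].
  by exists [set true] => //; rewrite setTI; apply/seteqP; split.
have := known_indep indep na (measurable_pred (@known_serving _ _ _ _ X n i)) e1.
rewrite (acoin_prob q01 model i) serving_fin -EFinM => <-.
by apply: (congr1 P); apply/seteqP; split=> w /=; [move/andP|move=> [-> ->]].
Qed.

Lemma measurable_inserted n : measurable_fun setT (fun w => inserted (s w) n).
Proof.
have thr i := all_through X i.
rewrite /inserted; under eq_fun do rewrite eseries_mkcond.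
apply: ge0_emeasurable_sum => [i w _ _|i _].
  case: ifP => // _; apply: adde_ge0 => //.
  by apply: nneseries_ge0.
apply: measurable_fun_ifT => //.
  by apply: measurable_fun_ltn => //; exact: measurable_through_index.
apply: emeasurable_funD.
  apply/measurable_EFinP.
  have [_ h2 _] := thr i.+1; have [mb _] := h2 i (ltnSn i).
  exact: measurableT_comp mb.
under eq_fun do rewrite eseries_mkcond.
apply: ge0_emeasurable_sum => [k w _ _|k _]; first by case: ifP.
apply: measurable_fun_ifT => //.
have [mc _] := measurable_clear_departure (thr i).
have [h1 _ _] := thr i.
apply: measurable_idle_insert => //.
by apply: measurable_arrival => l li; have [] := h1 l li.
Qed.

(** An insertion around job i requires that a coin of Alice, independent of
    serving n i, is up. *)
Lemma mean_inserted_le n M : 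
  (forall m, \sum_(i < m) fine (P [set w | serving X n i w]) <= M) ->
  (mean_inserted X n <= (q * bmax.+2%:R * M)%:E)%E.
Proof.
move=> hM; have /andP[q0 q1] := q01.
pose p i := fine (P [set w | serving X n i w]).
have p0 i : 0 <= p i by rewrite fine_ge0 ?measure_ge0.
pose bt i w : \bar R := (bmax%:R * (serving X n i w && racoin X i w)%:R)%:E.
pose ct i w : \bar R := (\sum_(k <oo) ((serving X n i w &&
  coins_up (icoin (s w) i) k)%:R)%:E)%E.
have bt0 i w : (0 <= bt i w)%E by rewrite lee_fin mulr_ge0.
have ct0 i w : (0 <= ct i w)%E by apply: nneseries_ge0 => k _ _; rewrite lee_fin.
have mbool (b : T -> bool) : measurable_fun setT b -> measurable_fun setT (fun w =>
  ((b w)%:R : R)%:E).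
  by move=> mb; apply/measurable_EFinP; exact: (tame_bool R mb).1.
have ms i : measurable_fun setT (serving X n i) by exact: measurable_serving.
have mc i k : measurable_fun setT (fun w => serving X n i w &&
  coins_up (icoin (s w) i) k).
  apply: measurable_and => //.
  exact: (@measurable_forall_ord _ _ k.+1 (fun j w => ricoin X i j w)).
have mct i : measurable_fun setT (ct i).
  by apply: ge0_emeasurable_sum => [k w _ _|k _]; [rewrite lee_fin|exact: mbool].
have msa i : measurable_fun setT (fun w => serving X n i w && racoin X i w).
  exact: measurable_and.
have mbt i : measurable_fun setT (bt i).
  apply/measurable_EFinP; apply: measurable_funM => //; exact: (tame_bool R (msa i)).1.
(* bt bounds the batch inserted after job i, ct the idle insertions before
   job i; almost surely no batch has more than bmax jobs. *)
apply: (@le_trans _ _ (\int[P]_w \sum_(i <oo) (bt i w + ct i w)))%E.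
  apply: ae_ge0_le_integral => //.
  - move=> w _; apply: nneseries_ge0 => i _ _; apply: adde_ge0 => //.
    exact: nneseries_ge0.
  - exact: measurable_inserted.
  - by move=> w _; apply: nneseries_ge0 => i _ _; exact: adde_ge0.
  - apply: ge0_emeasurable_sum => [i w _ _|i _]; first exact: adde_ge0.
    exact: emeasurable_funD.
  - apply: filterS (ae_size_bound model Q_bmax) => w sz _.
    rewrite /inserted eseries_mkcond; apply: lee_nneseries => [i _ _|i _].
      by case: ifP => // _; apply: adde_ge0 => //; exact: nneseries_ge0.
    case: ifPn => [iw|_]; last exact: adde_ge0.
    apply: leeD.
      rewrite /bt /serving iw/= lee_fin; case: ifP => _; last by rewrite mulr0.
      by rewrite mulr1 ler_nat.
    rewrite eseries_mkcond; apply: lee_nneseries => [k _ _|k _]; first by case: ifP.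
    rewrite /serving iw/=; case: ifPn => [/idle_insert_coins ->//|_].
    by rewrite lee_fin.
rewrite integral_nneseries//; last 2 first.
- by move=> i; exact: emeasurable_funD.
- by move=> i w _; exact: adde_ge0.
have intle i : (\int[P]_w (bt i w + ct i w) <= (q * bmax.+2%:R * p i)%:E)%E.
  rewrite ge0_integralD//.
  have -> : (\int[P]_w bt i w = (bmax%:R * (p i * q))%:E)%E.
    rewrite EFinM -acoin_mean -integral_bool//.
    by rewrite -ge0_integralZl//; exact: mbool.
  rewrite integral_nneseries//; last by move=> k; exact: mbool.
  under eq_eseriesr do rewrite coins_mean EFinM.
  rewrite nneseriesZl//; last by move=> k _; rewrite lee_fin exprn_ge0.
  apply: (@le_trans _ _ ((bmax%:R * (p i * q))%:E + (p i)%:E * (2 * q)%:E)%E).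
    by rewrite leeD2l//; apply: lee_wpmul2l; [rewrite lee_fin; exact: p0|exact:
      (idle_series_le q01 q_half)].
  rewrite -EFinM -EFinD lee_fin -addn2 natrD le_eqVlt; apply/orP; left.
  by apply/eqP; ring.
apply: (@le_trans _ _ (\sum_(i <oo) (q * bmax.+2%:R * p i)%:E)%E).
  apply: lee_nneseries => // i _ _; apply: integral_ge0 => w _; exact: adde_ge0.
apply: lime_le.
  by apply: is_cvg_nneseries => i _ _; rewrite lee_fin !mulr_ge0.
apply: nearW => m; rewrite sumEFin lee_fin -mulr_sumr ler_wpM2l ?mulr_ge0//.
by rewrite big_mkord; exact: hM.
Qed.

End mean_inserted.

(** * Concentration of the number of quick W-BPs *)

Section quick_test.
Context d (T : measurableType d) (R : realType) (P : probability T R).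
Variables (lam mu1 mu2 q : R) (Q : probability nat R) (X : primitives P).
Hypothesis lam_gt0 : 0 < lam.
Hypothesis mu1_gt0 : 0 < mu1.
Hypothesis mu2_gt0 : 0 < mu2.
Hypothesis q01 : 0 <= q <= 1.
Hypothesis model : iia_model lam mu1 mu2 q Q X.
Local Notation s := (path_H1 X).
Local Notation r := (quick_rate lam mu1 mu2 q).

Lemma quick_rate01 : 0 <= r <= 1.
Proof.
have /andP[q0 q1] := q01.
have e01 (x y : R) : 0 < x -> 0 < y -> 0 < expR (- x * y) <= 1.
  by move=> x0 y0; rewrite expR_gt0/= -expR0 ler_expR mulNr oppr_le0 mulr_ge0// ltW.
have /andP[a0 a1] := e01 _ _ mu1_gt0 (ltr01 : 0 < 1 :> R).
have /andP[b0 b1] := e01 _ _ mu1_gt0 (ltr0Sn R 1).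
have /andP[c0 c1] := e01 _ _ mu2_gt0 (ltr0Sn R 1).
have /andP[d0 d1] := e01 _ _ lam_gt0 (ltr01 : 0 < 1 :> R).
have ba : expR (- mu1 * 2) <= expR (- mu1 * 1).
  by rewrite ler_expR ler_wnM2l ?ler1n// oppr_le0 ltW.
rewrite /quick_rate; move: (expR (- mu1 * 1)) (expR (- mu1 * 2)) (expR (- mu2 * 2))
  (expR (- lam * 1)) a0 a1 b0 b1 c0 c1 d0 d1 ba => a b c e a0 a1 b0 b1 c0 c1 e0 e1 ba.
have h1 : 0 <= q * c * c * (1 - e) <= 1.
  rewrite !mulr_ge0 ?subr_ge0//= ?(ltW c0)//.
  rewrite !mulr_ile1 ?mulr_ge0 ?subr_ge0// ?(ltW c0)//.
  by rewrite gerBl ltW.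
have -> : (a - b) * q * c * c * (1 - e) = (a - b) * (q * c * c * (1 - e)) by ring.
move: (q * c * c * (1 - e)) h1 => z /andP[z0 z1].
by apply/andP; split; nra.
Qed.

Let deviation n m w := `|\sum_(i < m) (quick_opening (s w) n i)%:R -
  r * \sum_(i < m) (opening (s w) n i)%:R|.

Let measurable_sum_bool (b : nat -> T -> bool) m : (forall i,
  measurable_fun setT (b i)) ->
  measurable_fun setT (fun w => \sum_(i < m) (b i w)%:R : R).
Proof.
move=> mb; apply: (@measurable_sum_ord _ _ _ m (fun i w => (b i w)%:R)) => i _.
by have [] := tame_bool R (mb i).
Qed.

Let measurable_quick n m :
  measurable_fun setT (fun w => \sum_(i < m) (quick_opening (s w) n i)%:R : R).
Proof.
apply: (@measurable_sum_bool (fun i w => quick_opening (s w) n i)) => i.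
by apply: measurable_quick_opening; exact: all_through.
Qed.

Let measurable_deviation n m x : measurable [set w | x <= deviation n m w].
Proof.
apply: measurable_pred; apply: measurable_fun_ler => //.
apply: measurableT_comp => //; apply: measurable_funB; first exact: measurable_quick.
apply: measurable_funM => //; apply: (@measurable_sum_bool (fun i w =>
  opening (s w) n i)) => i.
by apply: measurable_opening; exact: all_through.
Qed.

Lemma quick_tail n m x : 0 < x ->
  (P [set w | (x <= `|\sum_(i < m) (quick_opening (s w) n i)%:R -
       r * \sum_(i < m) (opening (s w) n i)%:R|)%R] <= (n%:R / x ^+ 2)%:E)%E.
Proof.
have mq (I : set source) i : past i.+1 `<=` I ->
    measurable_fun (setT : set (known X I)) (fun w => quick_opening (s w) n i).
  by move=> pI; apply: measurable_quick_opening; exact: past_through.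
have mo (I : set source) i : past i.+1 `<=` I ->
    measurable_fun (setT : set (known X I)) (fun w => opening (s w) n i).
  by move=> pI; apply: measurable_opening; exact: past_through.
have ratio (b : nat -> T -> bool) i j : (i < j)%N ->
    (forall I : set source, past i.+1 `<=` I -> measurable_fun (setT :
      set (known X I)) (b i)) ->
    fine (P [set w | b i w && quick_opening (s w) n j]) =
    r * fine (P [set w | b i w && opening (s w) n j]).
  move=> ij mb.
  have kH : measurable ([set w | b i w] : set (known X (past j))).
    by apply: measurable_pred; apply: mb; exact: past_leq.
  have := quick_openings_ratio lam_gt0 q01 model n kH.
  have setE (b' : T -> bool) : [set w | b i w && b' w] =
    [set w | b i w] `&` [set w | b' w].
    by apply/seteqP; split=> w /=; [move/andP|move=> [-> ->]].
  rewrite !setE => ->; rewrite fineM// fin_num_measure//; apply: measurableI.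
    exact: known_measurable kH.
  apply: measurable_pred; apply: measurable_opening; exact: all_through.
move=> x0; apply: (@second_moment_tail _ _ _ _ (fun i w => quick_opening (s w) n i)
  (fun i w => opening (s w) n i)) => //.
- by move=> i; apply: measurable_quick_opening; exact: all_through.
- by move=> i; apply: measurable_opening; exact: all_through.
- by move=> i w /andP[].
- exact: quick_rate01.
- move=> i j ij; apply: (ratio (fun i w => quick_opening (s w) n i)) => // I pI; exact:
  mq.
- move=> i j ij; apply: (ratio (fun i w => opening (s w) n i)) => // I pI; exact: mo.
- by move=> w; exact: sum_opening.
Qed.

Lemma measurable_quick_record j :
  measurable_fun setT (fun w => quick_record (wbp_record (s w) j)).
Proof.
have thr i := all_through X i.
have mi i : measurable_fun setT (fun w => wbp_index (s w) i) by exact: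
  measurable_through_index.
apply: measurable_bool.
have -> : [set w | quick_record (wbp_record (s w) j)] = \bigcup_i \bigcup_m
    [set w | [&& opens_wbp (s w) i, wbp_index (s w) i == j, (j < wbp_index (s w) m)%N &
       recon (s w) i <= 2]].
  apply/seteqP; split=> w /=.
    move=> /andP[sz]; have [i [m [oi ij jm ->]]] := wbp_head_started sz => /= rt.
    by exists i => //; exists m => //=; apply/and4P; split=> //; apply/eqP.
  move=> [i _ [m _ /and4P[oi /eqP ij jm rt]]].
  have im : (wbp_index (s w) i < wbp_index (s w) m)%N by rewrite ij.
  have [sz headE] := wbp_head_record oi im.
  by rewrite /quick_record -ij sz headE.
apply: bigcupT_measurable => i; apply: bigcupT_measurable => m; apply: measurable_pred.
apply: measurable_and.
  case: i => [|i] /=; first exact: measurable_cst.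
  apply: measurable_fun_ler; first exact: measurable_departure.
  by apply: measurable_arrival => k ki; have [h1 _ _] := thr i.+1; have [] := h1 k ki.
apply: measurable_and; first by apply: measurable_fun_eqn.
apply: measurable_and; first by apply: measurable_fun_ltn.
by apply: measurable_fun_ler => //; exact: measurable_recon.
Qed.

Lemma measurable_quick_count n : measurable_fun setT (fun w =>
  (quick_count (s w) n)%:R : R).
Proof.
apply: (@measurableT_comp _ _ _ _ _ _ (fun k : nat => k%:R : R)) => //.
apply: (@measurable_sumn_ord _ _ n (fun j w =>
  nat_of_bool (quick_record (wbp_record (s w) j)))) => j _.
apply: measurable_nat_of_bool; exact: measurable_quick_record.
Qed.

Lemma ae_le_prob (A B : set T) : measurable A -> measurable B ->
  {ae P, forall w, A w -> B w} -> (P A <= P B)%E.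
Proof.
move=> mA mB [N [mN PN sub]].
apply: (@le_trans _ _ (P (B `|` N))).
  apply: le_measure; rewrite ?inE//; first exact: measurableU.
  move=> w Aw; have [Bw|nBw] := pselect (B w); [by left|right].
  by apply: sub => /= /(_ Aw).
apply: (le_trans (measureU2 _ mB mN)).
by rewrite [X in (_ + X)%E](_ : _ = 0%E) ?adde0//; exact: PN.
Qed.

(** Almost surely the event is contained in the increasing union over m of the
    events that the count over the first m jobs exceeds a, and quick_tail
    bounds the probabilities of these uniformly in m. *)
Lemma quick_count_upper n a : r * n%:R < a ->
  (P [set w | (a < (quick_count (s w) n)%:R)%R] <= (n%:R / (a - r * n%:R) ^+ 2)%:E)%E.
Proof.
move=> ra; have /andP[r0 r1] := quick_rate01.
pose B m := [set w | a < \sum_(i < m) (quick_opening (s w) n i)%:R].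
have mB m : measurable (B m).
  apply: measurable_pred; apply: measurable_fun_ltr => //.
have PB m : (P (B m) <= (n%:R / (a - r * n%:R) ^+ 2)%:E)%E.
  apply: le_trans (quick_tail n m (_ : 0 < a - r * n%:R)); last by rewrite subr_gt0.
  apply: le_measure; rewrite ?inE//; first exact: measurable_deviation.
  move=> w /= aw; apply: le_trans (ler_norm _).
  have : \sum_(i < m) (opening (s w) n i)%:R <= n%:R :> R.
    by rewrite -natr_sum ler_nat sum_opening.
  by move: aw; rewrite /B /= => aw h; nra.
have Bnd : nondecreasing_seq B.
  apply/nondecreasing_seqP => m; apply/subsetPset => w /= aw.
  by rewrite /B/= big_ord_recr/= ltr_wpDr.
apply: (@le_trans _ _ (P (\bigcup_m B m))).
  apply: ae_le_prob.
  - by apply: measurable_pred; apply: measurable_fun_ltr => //; exact: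
    measurable_quick_count.
  - exact: bigcupT_measurable.
  - apply: filterS (ae_nonneg_path model) => w w0 /= aw.
    have [m le_m] := quick_count_le w0 n; exists m => //.
    by rewrite /B/= (lt_le_trans aw)// -natr_sum ler_nat.
have cv := nondecreasing_cvg_mu (mu := P) mB (bigcupT_measurable B mB) Bnd.
rewrite -(cvg_lim _ cv)//; apply: lime_le; first by apply/cvg_ex; eexists; exact: cv.
by apply: nearW => m; exact: PB.
Qed.

(** If the first n W-BPs are completed before job m, then all n of them are
    opened by jobs before m, and their quick openings are all counted. *)
Lemma quick_count_lower n m a : (forall i k w, ricoin X i k w = false) ->
  (forall i w, racoin X i w = false) -> a < r * n%:R ->
  (P [set w | ((quick_count (s w) n)%:R <= a)%R] <=
   P [set w | serving X n m w] + (n%:R / (r * n%:R - a) ^+ 2)%:E)%E.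
Proof.
move=> c0 b0 ra.
have mt : measurable [set w | (r * n%:R - a <=
  `|\sum_(i < m) (quick_opening (s w) n i)%:R -
       r * \sum_(i < m) (opening (s w) n i)%:R|)%R].
  exact: measurable_deviation.
have ms : measurable [set w | serving X n m w].
  by apply: measurable_pred; exact: measurable_serving.
apply: (@le_trans _ _ (P ([set w | serving X n m w] `|` [set w | (r * n%:R - a <=
  `|\sum_(i < m) (quick_opening (s w) n i)%:R -
       r * \sum_(i < m) (opening (s w) n i)%:R|)%R]))).
  apply: ae_le_prob.
  - by apply: measurable_pred; apply: measurable_fun_ler => //; exact:
    measurable_quick_count.
  - exact: measurableU.
  - apply: filterS (ae_nonneg_path model) => w w0 /= qa.
    have [|nm] := ltnP (wbp_index (s w) m) n; [by left|right].
    have h1 : \sum_(i < m) (quick_opening (s w) n i)%:R <= a.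
      apply: le_trans qa; rewrite -natr_sum ler_nat.
      by apply: quick_count_ge => // [i k|k] /=; rewrite ?c0 ?b0.
    have h2 : n%:R <= \sum_(i < m) (opening (s w) n i)%:R :> R.
      by rewrite -natr_sum ler_nat; exact: sum_opening_ge.
    have /andP[r0 r1] := quick_rate01.
    rewrite distrC; apply: le_trans (ler_norm _); nra.
apply: (le_trans (measureU2 _ ms mt)); rewrite leeD2l//.
by apply: quick_tail; rewrite subr_gt0.
Qed.

End quick_test.

(** * The test and its error *)

Section no_insertion.
Context d (T : measurableType d) (R : realType) (P : probability T R).

(** The path of the silent primitives is the H0 path by computation, so that
    H0 is the policy with q = 0 and the results above apply to it. *)
Definition silent (X : primitives P) : primitives P :=
  Primitives (rgap X) (rwsvc X) (rbsvc X) (risvc X)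
    (fun _ _ => cst false : {RV P >-> bool}) (fun _ => cst false :
      {RV P >-> bool}) (rsize X).

Variables (lam mu1 mu2 q : R) (Q : probability nat R) (X : primitives P).
Hypothesis model : iia_model lam mu1 mu2 q Q X.

Let cst_law (Y : {RV P >-> bool}) : (forall w, Y w = false) ->
  has_law Y (bernoulli_prob 0).
Proof.
move=> Y0 A mA; rewrite bernoulli_probE ?lexx ?ler01// mul0e add0e unstable.onem0 mul1e.
rewrite /distribution /pushforward diracE; have [Af|nAf] := pselect (A false).
  rewrite mem_set// -[RHS](probability_setT P); apply: (congr1 P).
  by apply/seteqP; split=> // w _ /=; rewrite Y0.
rewrite memNset// -[RHS](measure0 P); apply: (congr1 P).
by apply/seteqP; split=> // w /=; rewrite Y0.
Qed.

Lemma silent_model : iia_model lam mu1 mu2 0 Q (silent X).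
Proof.
case: model => h1 h2 h3 h4 _ _ h7 h8; split => //.
- by move=> i k; exact: cst_law.
- by move=> i; exact: cst_law.
move=> J E JE; apply: h8 => u uJ; have := JE _ uJ.
have trivial (Y : {RV P >-> bool}) (A : set T) :
    preimage_set_system setT (cst false : T -> bool) measurable A ->
    preimage_set_system setT Y measurable A.
  move=> [B mB <-]; have [Bf|nBf] := pselect (B false).
    exists setT => //; apply/seteqP; split=> // w [_ _]; split=> //.
  exists set0 => //; apply/seteqP; split=> // w [_] //.
by case: u {uJ} => //= *; exact: trivial.
Qed.

End no_insertion.

(** The set of observations for which the test rejects H0. *)
Definition quick_set (R : realType) (n : nat) (a : R) : set (n.-tuple (record_space R)) :=
  [set t | (\sum_(j < n) quick_record (tnth t j : seq (R * R)))%N%:R <= a].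

Arguments quick_set {R} n a.

Lemma measurable_quick_set (R : realType) n (a : R) : measurable (quick_set n a).
Proof.
have mq : measurable_fun (setT : set (record_space R)) (quick_record (R := R)).
  apply: measurable_bool; rewrite /quick_record.
  have -> : [set r : seq (R * R) | (0 < size (r : seq (R * R)))%N && ((nth (0, 0) (r :
    seq (R * R)) 0).2 <= 2)] =
      [set r | (0 < size (r : seq (R * R)))%N] `&` [set r | (nth (0, 0) (r :
        seq (R * R)) 0).2 <= 2].
    by apply/seteqP; split=> r /=; [move/andP|move=> [-> ->]].
  apply: measurableI; apply: sub_sigma_algebra.
    left; exists [set k | (0 < k)%N] => //; by rewrite setTI.
  right; exists 0%N => //; exists [set p | p.2 <= 2]; last by rewrite setTI.
  by apply: measurable_pred; exact: measurable_fun_ler.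
apply: measurable_pred; apply: measurable_fun_ler => //.
apply: (@measurableT_comp _ _ _ _ _ _ (fun k : nat => k%:R : R)) => //.
pose f j (t : n.-tuple (record_space R)) :=
  if insub j is Some i then nat_of_bool (quick_record (tnth t i : seq (R * R))) else 0%N.
have -> : (fun t : n.-tuple (record_space R) => \sum_(j < n) quick_record (tnth t j :
  seq (R * R)))%N =
    (fun t => \sum_(j < n) f j t)%N.
  by apply/funext => t; apply: eq_bigr => j _; rewrite /f valK.
apply: measurable_sumn_ord => j jn; rewrite /f insubT/=.
apply: measurable_nat_of_bool; apply: measurableT_comp mq _; exact: measurable_tnth.
Qed.

Lemma quick_set_observation (R : realType) n (a : R) (s : sample_path R) :
  quick_set n a (observation n s) <-> (quick_count s n)%:R <= a.
Proof.
rewrite /quick_set /quick_count /=.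
by under eq_bigr do rewrite tnth_mktuple.
Qed.

Lemma min_error_quick d (T : measurableType d) (R : realType) (P : probability T R)
   (X : primitives P) n (a : R) :
  (min_error (law_H0 X n) (law_H1 X n) <=
   P [set w | ((quick_count (path_H1 (silent X) w) n)%:R <= a)%R] +
   P [set w | (a < (quick_count (path_H1 X w) n)%:R)%R])%E.
Proof.
have E1 : law_H0 X n (quick_set n a) =
  P [set w | ((quick_count (path_H1 (silent X) w) n)%:R <= a)%R].
  by apply: (congr1 P); apply/seteqP; split=> w /quick_set_observation.
have E2 : law_H1 X n (~` quick_set n a) =
  P [set w | (a < (quick_count (path_H1 X w) n)%:R)%R].
  apply: (congr1 P); apply/seteqP; split=> w /=.
    by move=> h; rewrite ltNge; apply/negP => /quick_set_observation.
  by rewrite ltNge => /negP h /quick_set_observation.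
rewrite -E1 -E2; apply: ereal_inf_lbound; exists (quick_set n a) => //.
exact: measurable_quick_set.
Qed.

(** * Conclusion *)

Lemma bounded_sums_small_term (R : realType) (p : nat -> R) (M e : R) : 0 < e ->
  (forall m, \sum_(i < m) p i <= M) -> exists m, p m <= e.
Proof.
move=> e0 hM; apply: contrapT => /forallNP big.
have lb m : m%:R * e <= \sum_(i < m) p i.
  elim: m => [|m IH]; first by rewrite mul0r big_ord0.
  rewrite big_ord_recr/= -natr1 mulrDl mul1r lerD// ltW// ltNge; exact/negP/big.
have := le_trans (lb (Num.bound `|M / e|)) (hM _).
rewrite -ler_pdivlMr// leNgt => /negP; apply.
exact: le_lt_trans (ler_norm _) (archi_boundP (normr_ge0 _)).
Qed.

Lemma finite_support_bound (R : realType) (Q : probability nat R) :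
  finite_set [set s : nat | Q [set s] <> 0%E] ->
  exists b : nat, forall k, (b < k)%N -> Q [set k] = 0%E.
Proof.
move=> /finite_seqP[t tE]; exists (\max_(i <- t) i)%N => k bk.
apply: contrapT => Qk; have : [set s : nat | Q [set s] <> 0%E] k by [].
rewrite tE/= => /(@leq_bigmax_seq _ t xpredT id _) /(_ isT).
by rewrite leqNgt bk.
Qed.

(** The decrease of quick_rate per unit of q. *)
Definition slow_gain (R : realType) (lam mu1 mu2 : R) : R :=
  (expR (- mu1 * 1) - expR (- mu1 * 2)) * expR (- mu2 * 2) * expR (- mu2 * 2) *
  (1 - expR (- lam * 1)).

Lemma slow_gain_gt0 (R : realType) (lam mu1 mu2 : R) :
  0 < lam -> 0 < mu1 -> 0 < slow_gain lam mu1 mu2.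
Proof.
move=> l0 m0; rewrite /slow_gain !mulr_gt0 ?expR_gt0// subr_gt0.
  by rewrite ltr_expR ltr_nM2l ?oppr_lt0// ltr1n.
by rewrite expR_lt1 mulr1 oppr_lt0.
Qed.

Lemma quick_rateE (R : realType) (lam mu1 mu2 q : R) :
  quick_rate lam mu1 mu2 q = quick_rate lam mu1 mu2 0 - slow_gain lam mu1 mu2 * q.
Proof. by rewrite /quick_rate /slow_gain; ring. Qed.

(** The threshold a is halfway between r(q) n and r(0) n, at distance
    x = g q n / 2 from both; by hypothesis n / x^2 <= 1/16, which bounds the
    two deviation probabilities. *)
Lemma min_error_small d (T : measurableType d) (R : realType) (P : probability T R)
    (lam mu1 mu2 q M : R) (Q : probability nat R) (X : primitives P) n :
  0 < lam -> 0 < mu1 -> 0 < mu2 -> 0 <= q <= 1 -> iia_model lam mu1 mu2 q Q X ->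
    (0 < n)%N ->
  (forall m, \sum_(i < m) fine (P [set w | serving (silent X) n i w]) <= M) ->
  8 / slow_gain lam mu1 mu2 <= q * Num.sqrt n%:R ->
  (min_error (law_H0 X n) (law_H1 X n) <= (4^-1)%:E)%E.
Proof.
move=> l0 m10 m20 q01 model n0 hM qn.
have g0 := slow_gain_gt0 mu2 l0 m10; set g := slow_gain _ _ _ in g0 qn.
have n0' : 0 < n%:R :> R by rewrite ltr0n.
have gqn : 8 <= g * q * Num.sqrt n%:R.
  by move: qn; rewrite ler_pdivrMr// mulrC mulrA.
have q0 : 0 < q.
  rewrite lt_neqAle eq_sym; case/andP: q01 => -> _; rewrite andbT.
  by apply/eqP => qE; move: gqn; rewrite qE mulr0 mul0r; lra.
pose r0 := quick_rate lam mu1 mu2 0; pose r := quick_rate lam mu1 mu2 q.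
have rE : r = r0 - g * q by rewrite /r quick_rateE.
pose x := g * q * n%:R / 2.
have x0 : 0 < x by rewrite /x divr_gt0// mulr_gt0// mulr_gt0.
pose a := r0 * n%:R - x.
have nx : n%:R / x ^+ 2 <= 16^-1.
  rewrite ler_pdivrMr ?exprn_gt0//.
  have -> : x ^+ 2 = (g * q * Num.sqrt n%:R) ^+ 2 * n%:R / 4.
    by rewrite /x exprMn !exprMn sqr_sqrtr ?ltW//; field.
  have h : 64 <= (g * q * Num.sqrt n%:R) ^+ 2.
    by rewrite (_ : 64 = 8 ^+ 2) ?ler_sqr ?nnegrE ?(le_trans _ gqn)//; ring.
  by move: h; set z := _ ^+ 2; nra.
have e8 : 0 < 8^-1 :> R by rewrite invr_gt0.
have [m pm] := bounded_sums_small_term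
  (p := fun i => fine (P [set w | serving (silent X) n i w])) e8 hM.
apply: (le_trans (min_error_quick X n a)).
have U : (P [set w | (a < (quick_count (path_H1 X w) n)%:R)%R] <= (16^-1)%:E)%E.
  have ra : r * n%:R < a.
    by rewrite rE /a mulrBl ltrD2l ltrN2 /x; move: x0; rewrite /x; lra.
  apply: (le_trans (quick_count_upper l0 m10 m20 q01 model ra)).
  rewrite lee_fin (_ : a - _ = x)//.
  by rewrite -/r rE /a /x; field.
have L : (P [set w | ((quick_count (path_H1 (silent X) w) n)%:R <= a)%R] <= (8^-1)%:E +
  (16^-1)%:E)%E.
  have ar : a < r0 * n%:R by rewrite /a; lra.
  have z01 : (0 : R) <= (0 : R) <= (1 : R) by rewrite lexx ler01.
  apply: (le_trans (quick_count_lower l0 m10 m20 z01 (silent_model model) m _ _ ar)) =>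
    //.
  apply: leeD.
    rewrite -[X in (X <= _)%E]fineK ?lee_fin// fin_num_measure//.
    by apply: measurable_pred; exact: measurable_serving.
  by rewrite lee_fin (_ : _ - a = x)// -/r0 /a; ring.
apply: (le_trans (leeD L U)); rewrite -!EFinD lee_fin.
by lra.
Qed.

Lemma limn_einf_le_near (R : realType) (u : (\bar R)^nat) (l : \bar R) :
  (\forall n \near \oo, (u n <= l)%E) -> (limn_einf u <= l)%E.
Proof.
move=> ul; rewrite limn_einf_lim; apply: lime_le; first exact: is_cvg_einfs.
apply: filterS ul => n; apply: le_trans.
by apply: ereal_inf_lbound; exists n => /=.
Qed.

Theorem proposition11p4 (R : realType) (lam mu1 mu2 : R)
    (Q : probability nat R) :
  0 < lam -> 0 < mu1 -> 0 < mu2 ->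
  lam / mu1 < 1 ->
  finite_set [set s : nat | Q [set s] <> 0%E] ->
  exists2 eps0 : R, 0 < eps0 &
    forall (d : measure_display) (Omega : measurableType d)
      (P : probability Omega R) (q : nat -> R) (X : nat -> primitives P),
      (forall n, 0 <= q n <= 1) ->
      (forall n, ((lam / mu1)%:E + (q n * (lam / mu2))%:E * mean_batch Q
                  < 1)%E) ->
      (forall n, iia_model lam mu1 mu2 (q n) Q (X n)) ->
      (fun n => mean_inserted (X n) n * (Num.sqrt n%:R)^-1%:E)%E @ \oo
        --> +oo%E ->
      (limn_einf (fun n => min_error (law_H0 (X n) n) (law_H1 (X n) n))
       < (1 - eps0)%:E)%E.
Proof.
move=> l0 m10 m20 rho /finite_support_bound[b Qb].
have [q0 [C [q00 q0h C0 bound]]] := serving_bound b l0 m10 m20 rho.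
have g0 := slow_gain_gt0 mu2 l0 m10.
exists 2^-1; first by rewrite invr_gt0.
move=> d T P q X q01 _ model inserted_oo.
pose M := 8 / slow_gain lam mu1 mu2.
have M0 : 0 < M by rewrite divr_gt0.
pose D := b.+2%:R * C.
have D0 : 0 < D by rewrite mulr_gt0// ltr0n.
apply: (@le_lt_trans _ _ (4^-1)%:E); last by rewrite lte_fin; lra.
apply: limn_einf_le_near; near=> n.
have n0 : (0 < n)%N by near: n; exists 1%N.
have sn0 : 0 < Num.sqrt n%:R :> R by rewrite sqrtr_gt0 ltr0n.
have nE : n%:R = Num.sqrt n%:R * Num.sqrt n%:R :> R by rewrite -expr2 sqr_sqrtr.
have large : M <= q0 * Num.sqrt n%:R.
  have qM0 : 0 <= q0^-1 * M by rewrite mulr_ge0 ?invr_ge0// ltW.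
  rewrite -ler_pdivrMl// -ler_sqr ?nnegrE ?sqrtr_ge0// sqr_sqrtr// ltW//.
  by near: n; exact: nbhs_infty_gtr.
have Tn : ((D * M)%:E <= mean_inserted (X n) n * (Num.sqrt n%:R)^-1%:E)%E.
  near: n; by move/cvgeyPge : inserted_oo; apply.
apply: (min_error_small l0 m10 m20 (q01 n) (model n) n0).
  move=> m; apply: (bound _ _ _ 0 Q) => //; first by rewrite lexx ltW.
  exact: silent_model (model n).
have /andP[qn0 qn1] := q01 n.
have [qle|qgt] := leP (q n) q0; last first.
  by apply: (le_trans large); rewrite ler_wpM2r// ltW.
have qh : q n <= 2^-1 := le_trans qle q0h.
have qn_q0 : 0 <= q n <= q0 by rewrite qn0 qle.
have := mean_inserted_le (q01 n) qh (model n) Qb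
  (fun m => bound _ _ _ _ _ _ n m qn_q0 (model n) Qb n0).
have sV0 : (0 <= ((Num.sqrt n%:R)^-1)%:E :> \bar R)%E by rewrite lee_fin invr_ge0 ltW.
move=> /(lee_wpmul2r sV0) /(le_trans Tn); rewrite -EFinM lee_fin => le_T.
rewrite -(ler_pM2l D0) -/M; apply: le_trans le_T _.
move: nE sn0; set y := Num.sqrt _ => nE y0.
rewrite nE /D le_eqVlt; apply/orP; left; apply/eqP; field.
by rewrite gt_eqF.
Unshelve. all: end_near.
Qed.
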